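(* Let $\Gamma$ be a countable discrete group and $(X,\mu)$ a standard probability space. Then $\mathrm{A}_\sim(\Gamma,X,\mu)$, with the topology induced by the metric $d$, is path connected.
   Context: A probability space is a standard Borel space with a Borel probability measure (atoms allowed); it is a standard probability space if the measure is nonatomic. A measure-preserving action of $\Gamma$ on $(Y,\nu)$ is a Borel action preserving $\nu$, two actions being identified if they agree almost everywhere; $\gamma^a$ denotes the transformation given by $\gamma\in\Gamma$ under the action $a$. $\mathrm{A}(\Gamma,X,\mu)$ is the set of measure-preserving actions of $\Gamma$ on $(X,\mu)$. Weak containment: for actions $a$ on $(X,\mu)$ and $b$ on $(Y,\nu)$, $a\prec b$ if for all measurable $A_1,\dots,A_n\subseteq X$, finite $F\subseteq\Gamma$ and $\epsilon>0$ there are measurable $B_1,\dots,B_n\subseteq Y$ with $|\mu(\gamma^aA_i\cap A_j)-\nu(\gamma^bB_i\cap B_j)|<\epsilon$ for all $\gamma\in F$, $i,j\le n$. $a\sim b$ means $a\prec b$ and $b\prec a$, and $\mathrm{A}_\sim(\Gamma,X,\mu)=\mathrm{A}(\Gamma,X,\mu)/\!\sim$. Topology: fix an enumeration $(\gamma_i)_{i\ge1}$ of $\Gamma$ (with repetitions if $\Gamma$ is finite). For $a\in \mathrm{A}(\Gamma,X,\mu)$ and a measurable partition $\mathcal A=\{A_1,\dots,A_k\}$ of $X$ into $k$ pieces let $M^{\mathcal A}_{n,k}(a)\in[0,1]^{n\times k\times k}$ have $(p,q,r)$ coordinate $\mu(\gamma_p^aA_q\cap A_r)$, let $C_{n,k}(a)$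 be the closure of the set of all $M^{\mathcal A}_{n,k}(a)$ over such $\mathcal A$, and let $d(a,b)=\sum_{n,k=1}^\infty 2^{-(n+k)}d_H(C_{n,k}(a),C_{n,k}(b))$, where $d_H$ is the Hausdorff distance (from the supremum metric on $[0,1]^{n\times k\times k}$). Then $d(a,b)=0$ iff $a\sim b$, so $d$ induces a metric on $\mathrm{A}_\sim(\Gamma,X,\mu)$. *)

(* Defs.v *)
From HB Require Import structures.
From mathcomp Require Import all_boot all_order all_algebra.
From mathcomp Require Import generic_quotient.
From mathcomp Require Import all_classical all_reals all_analysis.
From mathcomp Require Import ring lra.

Set Implicit Arguments.
Unset Strict Implicit.
Unset Printing Implicit Defensive.

Import Order.TTheory GRing.Theory Num.Theory.
Import numFieldNormedType.Exports.

Local Open Scope classical_set_scope.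
Local Open Scope ring_scope.

(* X is isomorphic, as a measurable space, to a complete separable metric
   space equipped with its Borel sigma-algebra. *)
Definition standard_borel (R : realType) (d : measure_display)
    (X : measurableType d) : Prop :=
  exists (P : metricType R) (f : X -> P),
    [/\ forall F : set_system P, ProperFilter F -> cauchy F -> exists p : P, F --> p,
        exists2 D : set P, countable D & dense D,
        bijective f &
        forall A : set X, measurable A <-> <<s @open P >> (f @` A)].

Definition nonatomic (R : realType) (d : measure_display)
    (X : measurableType d) (mu : probability X R) : Prop :=
  forall A, measurable A -> (0 < mu A)%E ->
    exists B, [/\ measurable B, B `<=` A, (0 < mu B)%E & (mu B < mu A)%E].

Definition path_connected (R : realType) (T : topologicalType) : Prop :=
  forall x y : T, exists f : R -> T,
    [/\ {within `[0, 1], continuous f}, f 0 = x & f 1 = y].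

(* Almost everywhere equal actions are not identified at this stage: they are
   weakly equivalent (lemma [ae_eq_weak_equiv]), hence equal in [weak_quot]. *)
Record mp_action (R : realType) (G : groupType) (d : measure_display)
    (X : measurableType d) (mu : probability X R) := MpAction {
  act :> G -> X -> X ;
  act_measurable : forall g, measurable_fun setT (act g) ;
  act1 : forall x, act 1%g x = x ;
  actM : forall g h x, act (g * h)%g x = act g (act h x) ;
  act_preserving : forall g A, measurable A -> mu (act g @^-1` A) = mu A }.

Definition weakly_contained (R : realType) (G : groupType)
    (d d' : measure_display) (X : measurableType d) (Y : measurableType d')
    (mu : probability X R) (nu : probability Y R)
    (a : mp_action G mu) (b : mp_action G nu) : Prop :=
  forall (n : nat) (A : 'I_n -> set X) (F : set G) (e : R),
    (forall i, measurable (A i)) -> finite_set F -> 0 < e ->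
    exists B : 'I_n -> set Y, (forall i, measurable (B i)) /\
      forall g i j, F g ->
        `|fine (mu (a g @` A i `&` A j)) - fine (nu (b g @` B i `&` B j))| < e.

Section prob.
Context (R : realType) (d : measure_display) (X : measurableType d).
Variable mu : probability X R.
Local Notation P A := (fine (mu A)).

Lemma pr_EFin A : measurable A -> (fine (mu A))%:E = mu A.
Proof. by move=> mA; rewrite fineK// fin_num_measure. Qed.

Lemma pr_ge0 A : 0 <= P A.
Proof. exact: fine_ge0. Qed.

Lemma pr_le A B : measurable A -> measurable B -> A `<=` B -> P A <= P B.
Proof.
by move=> mA mB AB; rewrite -lee_fin !pr_EFin// le_measure// ?inE.
Qed.

Lemma pr_sum n (F : 'I_n -> set X) (Q : pred 'I_n) :
  (forall i, measurable (F i)) -> trivIset setT F ->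
  P (\big[setU/set0]_(i < n | Q i) F i) = \sum_(i < n | Q i) P (F i).
Proof.
move=> mF tF; rewrite measure_bigsetU_ord// -[RHS]/(fine (_ %:E)) -sumEFin.
by congr fine; apply: eq_bigr => i _; rewrite pr_EFin.
Qed.

Lemma pr_le_sum n (F : 'I_n -> set X) (Q : pred 'I_n) A :
  (forall i, measurable (F i)) -> measurable A ->
  A `<=` \bigcup_(i in [set i | Q i]) F i -> P A <= \sum_(i < n | Q i) P (F i).
Proof.
move=> mF mA AF; rewrite -lee_fin -sumEFin pr_EFin//.
under eq_bigr do rewrite pr_EFin//.
rewrite -big_filter fsbig_seq ?filter_uniq ?index_enum_uniq//=.
rewrite (_ : [set` _] = [set i | Q i]); first by apply: content_sub_fsum => //; exact: finite_finset.
by apply/seteqP; split=> i /=; rewrite mem_filter mem_index_enum ?andbT.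
Qed.

Lemma pr_D A B : measurable A -> measurable B ->
  P A = P (A `&` B) + P (A `\` B).
Proof.
move=> mA mB; apply: EFin_inj; rewrite EFinD !pr_EFin//.
- by rewrite addeC -measureDI.
- exact: measurableD.
- exact: measurableI.
Qed.

Lemma pr_T : P setT = 1.
Proof. by rewrite probability_setT. Qed.

End prob.

Section action.
Context (R : realType) (G : groupType) (d : measure_display).
Context (X : measurableType d) (mu : probability X R).
Implicit Type a : mp_action G mu.
Local Notation P A := (fine (mu A)).

Lemma act_imageE a g A : a g @` A = a g^-1%g @^-1` A.
Proof.
apply/seteqP; split => [_ [x Ax <-]|x /= Ax]; first by rewrite /= -actM mulVg act1.
by exists (a g^-1%g x) => //; rewrite -actM mulgV act1.
Qed.

Lemma measurable_act a g A : measurable A -> measurable (a g @` A).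
Proof.
by move=> mA; rewrite act_imageE -[_ @^-1` _]setTI; exact: act_measurable.
Qed.
Local Hint Resolve measurable_act : core.

Lemma pr_act a g A : measurable A -> P (a g @` A) = P A.
Proof. by move=> mA; rewrite act_imageE act_preserving. Qed.

Lemma act1_image a A : a 1%g @` A = A.
Proof.
apply/seteqP; split => [_ [x Ax <-]|x Ax]; first by rewrite act1.
by exists x => //; rewrite act1.
Qed.

Lemma cor_perturb a g A A' B B' :
  measurable A -> measurable A' -> measurable B -> measurable B' ->
  P (a g @` A `&` B) <=
  P (a g @` A' `&` B') + P (A `\` A') + P (B `\` B').
Proof.
move=> mA mA' mB mB'.
have mD : measurable (A `\` A') by exact: measurableD.
pose F (i : 'I_3) := nth set0 [:: a g @` A' `&` B'; a g @` (A `\` A'); B `\` B'] i.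
have mF i : measurable (F i).
  case: i => -[|[|[|//]]] ?; rewrite /F/=; [|exact: measurable_act|exact: measurableD].
  by apply: measurableI => //; exact: measurable_act.
have mL : measurable (a g @` A `&` B).
  by apply: measurableI => //; exact: measurable_act.
have := @pr_le_sum _ _ _ mu 3 F xpredT _ mF mL.
rewrite !big_ord_recl big_ord0 addr0 /F/= pr_act// addrA; apply.
move=> _ [[x Ax <-] Bx].
have [A'x|nA'x] := pselect (A' x); last by exists (@Ordinal 3 1 isT) => //; exists x.
have [B'x|nB'x] := pselect (B' (a g x)); last by exists (@Ordinal 3 2 isT).
by exists (@Ordinal 3 0 isT) => //; split => //; exists x.
Qed.

Lemma cor_sum a g n (F : 'I_n -> set X) (Q S : pred 'I_n) :
  (forall i, measurable (F i)) -> trivIset setT F ->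
  P (a g @` (\big[setU/set0]_(i < n | Q i) F i) `&`
     (\big[setU/set0]_(j < n | S j) F j)) =
  \sum_(i < n | Q i) \sum_(j < n | S j) P (a g @` F i `&` F j).
Proof.
move=> mF tF.
rewrite act_imageE (big_morph (fun A => a g^-1%g @^-1` A) (id1 := set0) (op1 := setU))//.
under eq_bigr do rewrite -act_imageE.
rewrite big_distrl/=.
have mI i j : measurable (a g @` F i `&` F j).
  by apply: measurableI => //; exact: measurable_act.
rewrite (@pr_sum _ _ _ mu n
    (fun i => a g @` F i `&` \big[setU/set0]_(j < n | S j) F j) Q).
- apply: eq_bigr => i _; rewrite big_distrr/=.
  rewrite (@pr_sum _ _ _ mu n (fun j => a g @` F i `&` F j) S)//.
  apply/trivIsetP => j k _ _ jk; move/trivIsetP : tF => /(_ j k I I jk).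
  rewrite -!subset0 => H x [[_ Fx] [_ Fx']]; exact: (H x).
- move=> i; apply: measurableI; first exact: measurable_act.
  exact: bigsetU_measurable.
- apply/trivIsetP => j k _ _ jk; move/trivIsetP : tF => /(_ j k I I jk).
  rewrite -!subset0 => H _ [[[x Fx <-] _] [[y Fy xy] _]].
  apply: (H x); split => //.
  have : a g^-1%g (a g y) = a g^-1%g (a g x) by rewrite xy.
  by rewrite -!actM mulVg !act1 => <-.
Qed.

End action.

Section membership.
Context (d : measure_display) (X : measurableType d) (n : nat).
Variable B : 'I_n -> set X.

Definition memb (x : X) : {ffun 'I_n -> bool} := [ffun i => `[< B i x >]].

Lemma memb_measurable (D : set {ffun 'I_n -> bool}) :
  (forall i, measurable (B i)) -> measurable (memb @^-1` D).
Proof.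
move=> mB; rewrite (_ : _ @^-1` _ = \bigcup_(t in D) \bigcap_(i in [set: 'I_n])
    (if t i then B i else ~` B i)).
  apply: fin_bigcup_measurable => // t _.
  apply: fin_bigcap_measurable => // i _.
  by case: (t i) => //; exact: measurableC.
apply/seteqP; split => [x Dx|x [t Dt tx]] /=.
  exists (memb x) => // i _; rewrite ffunE.
  by case: asboolP.
suff -> : memb x = t by [].
apply/ffunP => i; rewrite ffunE; have := tx i I.
by case: (t i) => h; apply/asboolP.
Qed.

End membership.

Lemma sumr_le_const (R : numDomainType) n (Q : pred 'I_n) (f : 'I_n -> R) c :
  0 <= c -> (forall i, f i <= c) -> \sum_(i < n | Q i) f i <= n%:R * c.
Proof.
move=> c0 fc; apply: (@le_trans _ _ (\sum_(i < n) c)).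
  rewrite big_mkcond/=; apply: ler_sum => i _; by case: ifP.
by rewrite sumr_const card_ord mulr_natl.
Qed.

(* Ordered partition into k measurable, possibly empty pieces. *)
Definition mpartition (d : measure_display) (X : measurableType d) (k : nat)
    (A : 'I_k -> set X) : Prop :=
  [/\ forall i, measurable (A i), trivIset setT A & \bigcup_i A i = setT].

Lemma memb_mpartition (d : measure_display) (X : measurableType d) n k
    (B : 'I_n -> set X) (h : {ffun 'I_n -> bool} -> 'I_k) :
  (forall i, measurable (B i)) ->
  mpartition (fun i => (h \o memb B) @^-1` [set i]).
Proof.
move=> mB; split.
- by move=> i; rewrite comp_preimage; exact: memb_measurable.
- apply/trivIsetP => i j _ _ ij; rewrite -subset0 => x [/= -> ji].
  by rewrite ji eqxx in ij.
- by apply/seteqP; split => // x _; exists (h (memb B x)).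
Qed.

Lemma mpartition_pr (R : realType) (d : measure_display) (X : measurableType d)
    (mu : probability X R) k (A : 'I_k -> set X) :
  mpartition A -> \sum_(i < k) fine (mu (A i)) = 1.
Proof.
case=> mA tA UA; rewrite -(@pr_sum _ _ _ mu _ A xpredT)//.
rewrite -bigcup_seq (_ : [set` _] = setT) ?UA ?pr_T//.
by apply/seteqP; split => // i _; rewrite /= mem_index_enum.
Qed.

Lemma mpartition_gt0 (R : realType) (d : measure_display) (X : measurableType d)
    (mu : probability X R) k (A : 'I_k -> set X) : mpartition A -> (0 < k)%N.
Proof.
case: k A => // A /(mpartition_pr mu); rewrite big_ord0 => /eqP.
by rewrite eq_sym oner_eq0.
Qed.

Section approximation.
Context (R : realType) (G : groupType) (d d' : measure_display).
Context (X : measurableType d) (Y : measurableType d').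
Context (mu : probability X R) (nu : probability Y R).
Variables (a : mp_action G mu) (b : mp_action G nu).

Lemma weakly_contained_mpartition k (A : 'I_k -> set X) (F : set G) (e : R) :
  weakly_contained a b -> mpartition A -> finite_set F -> 0 < e ->
  exists B : 'I_k -> set Y, mpartition B /\
    forall g i j, F g ->
      `|fine (mu (a g @` A i `&` A j)) - fine (nu (b g @` B i `&` B j))| < e.
Proof.
move=> wab pA fF e0; have k0 := mpartition_gt0 mu pA.
have [mA tA _] := pA.
pose K : R := k%:R; have K0 : 0 <= K by exact: ler0n.
pose D := 1 + 2 * (K * (K + 1)) + 2 * (K * (K + 1)).
have D1 : 1 <= D by rewrite /D; nra.
have D0 : 0 < D by rewrite (lt_le_trans _ D1).
pose del := e / D; have del0 : 0 < del by exact: divr_gt0.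
have eD : e = del * D by rewrite /del divfK// gt_eqF.
have fF1 : finite_set (1%g |` F) by rewrite finite_setU; split.
have [B [mB HB]] := wab k A _ del mA fF1 del0.
have mact g C : measurable C -> measurable (b g @` C) by exact: measurable_act.
have B1 i j : `|fine (mu (A i `&` A j)) - fine (nu (B i `&` B j))| < del.
  by have := HB 1%g i j (or_introl erefl); rewrite !act1_image.
pose h (t : {ffun 'I_k -> bool}) : 'I_k := odflt (Ordinal k0) [pick i | t i].
pose B' i := (h \o memb B) @^-1` [set i].
have pB' : mpartition B' by exact: memb_mpartition.
have [mB' tB' _] := pB'.
have hB x j : B j x -> B (h (memb B x)) x.
  rewrite /h; case: pickP => [i|/(_ j)]; rewrite ffunE; first by move/asboolP.
  by move=> + Bj; rewrite asboolT.
have u_le i : fine (nu (B i `\` B' i)) <= K * del.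
  have := @pr_le_sum _ _ _ nu k (fun j => B i `&` B j) (fun j => j != i) (B i `\` B' i).
  move=> H; apply: le_trans (H _ _ _) _.
  - by move=> j; exact: measurableI.
  - exact: measurableD.
  - move=> x [Bx /= hx]; exists (h (memb B x)); first by apply/eqP.
    by split => //; exact: hB Bx.
  rewrite big_mkcond/=; apply: (@sumr_le_const _ _ xpredT _ del); first exact: ltW.
  move=> j; case: ifPn => [ji|_]; last exact: ltW.
  have := B1 i j; move/trivIsetP : tA => /(_ i j I I); rewrite eq_sym => /(_ ji) ->.
  by rewrite measure0/= sub0r normrN => /ltW; apply: le_trans; exact: ler_norm.
have x_le i : fine (nu (B' i `\` B i)) <= K * ((K + 1) * del).
  apply: (@le_trans _ _ (\sum_(j < k) fine (nu (B' j `\` B j)))).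
    by rewrite (bigD1 i)//= lerDl sumr_ge0// => j _; exact: pr_ge0.
  have xE j : fine (nu (B' j `\` B j)) =
      fine (nu (B' j)) - fine (nu (B' j `&` B j)).
    by rewrite (pr_D nu (mB' j) (mB j)) addrC addKr.
  have yE j : fine (mu (A j)) - (K + 1) * del <= fine (nu (B' j `&` B j)).
    have := pr_D nu (mB j) (mB' j); have := u_le j; have := B1 j j.
    rewrite !setIid (setIC (B' j)) ltr_distl => /andP[]; lra.
  rewrite (eq_bigr _ (fun j _ => xE j)) sumrB (mpartition_pr nu pB').
  have : \sum_(j < k) (fine (mu (A j)) - (K + 1) * del) <=
      \sum_(j < k) fine (nu (B' j `&` B j)) by apply: ler_sum => j _; exact: yE.
  rewrite sumrB (mpartition_pr mu pA) sumr_const card_ord -mulr_natl -/K; lra.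
exists B'; split => // g i j Fg.
have := HB g i j (or_intror Fg).
have c1 := cor_perturb b g (mB i) (mB' i) (mB j) (mB' j).
have c2 := cor_perturb b g (mB' i) (mB i) (mB' j) (mB j).
have := u_le i; have := u_le j; have := x_le i; have := x_le j.
have KK : K * del <= K * ((K + 1) * del).
  by rewrite ler_wpM2l//; have := mulr_ge0 K0 (ltW del0); lra.
rewrite eD /D mulrDr mulrDr mulr1 !ltr_distl.
have -> : del * (2 * (K * (K + 1))) = 2 * (K * ((K + 1) * del)) by ring.
move=> ? ? ? ? /andP[? ?]; apply/andP; split; lra.
Qed.

Lemma mpartition_weakly_contained (gam : {surj [set: nat] >-> [set: G]}) :
  (forall (n k : nat) (A : 'I_k -> set X) (e : R),
    (0 < n)%N -> (0 < k)%N -> mpartition A -> 0 < e ->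
    exists B : 'I_k -> set Y, mpartition B /\
      forall (p : 'I_n) i j,
        `|fine (mu (a (gam p) @` A i `&` A j)) -
          fine (nu (b (gam p) @` B i `&` B j))| < e) ->
  weakly_contained a b.
Proof.
move=> H n A F e mA /finite_seqP[s ->] e0.
have [N [N0 HN]] : exists N, (0 < N)%N /\ forall g, g \in s ->
    exists2 p, (p < N)%N & gam p = g.
  elim: s => [|g s [N [N0 IH]]]; first by exists 1%N.
  have [p _ pg] := @surj _ _ _ _ gam g I.
  exists (maxn N p.+1); split; first by rewrite leq_max N0.
  move=> g'; rewrite inE => /orP[/eqP ->|/IH[q qN <-]].
    by exists p => //; rewrite leq_max leqnn orbT.
  by exists q => //; rewrite leq_max qN.
pose T := {ffun 'I_n -> bool}.
have t0 : T := [ffun=> true].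
have K0 : (0 < #|T|)%N by apply/card_gt0P; exists t0.
pose K : R := #|T|%:R.
have KK : 0 <= K * K by rewrite mulr_ge0// ler0n.
pose del := e / (K * K + 1).
have del0 : 0 < del by rewrite divr_gt0// ltr_wpDl.
pose Pt (i : 'I_#|T|) := (enum_rank \o memb A) @^-1` [set i].
have pP : mpartition Pt by exact: memb_mpartition.
have [mP tP _] := pP.
have [Q [pQ HQ]] := H N #|T| Pt del N0 K0 pP del0.
have [mQ tQ _] := pQ.
have AE i : A i = \big[setU/set0]_(q < #|T| | (enum_val q : T) i) Pt q.
  rewrite -bigcup_seq_cond; apply/seteqP; split => x /=.
    move=> Ax; exists (enum_rank (memb A x)) => //=.
    by rewrite mem_index_enum enum_rankK ffunE; exact/asboolP.
  by move=> [q /= /andP[_ +] /= qE]; rewrite -qE enum_rankK ffunE => /asboolP.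
exists (fun i => \big[setU/set0]_(q < #|T| | (enum_val q : T) i) Q q); split.
  by move=> i; exact: bigsetU_measurable.
move=> _ i j /HN[p pN <-].
rewrite 2!AE !cor_sum// -sumrB; under eq_bigr do rewrite -sumrB.
apply: le_lt_trans (ler_norm_sum _ _ _) _.
apply: (@le_lt_trans _ _ (K * (K * del))).
  apply: sumr_le_const => [|q]; first by rewrite mulr_ge0 ?ler0n ?ltW.
  apply: le_trans (ler_norm_sum _ _ _) _.
  apply: sumr_le_const => [|r]; first exact: ltW.
  exact/ltW/(HQ (Ordinal pN)).
have eE : e = del * (K * K + 1) by rewrite /del divfK// gt_eqF// ltr_wpDl.
by rewrite [ltRHS]eE mulrA mulrDr mulr1 mulrC ltrDl.
Qed.

End approximation.

Definition hausdorff_edist (R : realType) (T : pseudoMetricType R)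
    (A B : set T) : \bar R :=
  maxe (ereal_sup [set edist_inf B x | x in A])
       (ereal_sup [set edist_inf A y | y in B]).

Section hausdorff_edist_lemmas.
Context (R : realType) (T : pseudoMetricType R).
Implicit Types A B C : set T.
Local Open Scope ereal_scope.

Lemma hausdorff_edist_sym A B : hausdorff_edist A B = hausdorff_edist B A.
Proof. by rewrite /hausdorff_edist maxC. Qed.

Lemma hausdorff_edist_ge0 A B : A !=set0 -> 0 <= hausdorff_edist A B.
Proof.
move=> [x Ax]; rewrite le_max; apply/orP; left.
apply: le_trans (edist_inf_ge0 B x) _.
by apply: ereal_sup_ubound; exists x.
Qed.

Lemma hausdorff_edist_leP A B e : hausdorff_edist A B <= e <->
  (forall x, A x -> edist_inf B x <= e) /\ (forall y, B y -> edist_inf A y <= e).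
Proof.
rewrite ge_max; split.
  move=> /andP[hA hB]; split => x hx.
    by apply: le_trans hA; apply: ereal_sup_ubound; exists x.
  by apply: le_trans hB; apply: ereal_sup_ubound; exists x.
by move=> [hA hB]; apply/andP; split; apply: ge_ereal_sup => _ [x hx <-];
  [exact: hA|exact: hB].
Qed.

Lemma hausdorff_edist_refl A : hausdorff_edist A A <= 0.
Proof. by apply/hausdorff_edist_leP; split => x Ax; rewrite edist_inf0. Qed.

Lemma hausdorff_edist_triangle A B C : B !=set0 ->
  hausdorff_edist A C <= hausdorff_edist A B + hausdorff_edist B C.
Proof.
move=> B0; have B0' := B0.
have aux A' C' x : A' x ->
    edist_inf C' x <= hausdorff_edist A' B + hausdorff_edist B C'.
  move=> A'x; have [hAB _] := (hausdorff_edist_leP A' B _).1 (lexx _).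
  have [hBC _] := (hausdorff_edist_leP B C' _).1 (lexx _).
  apply: (@le_trans _ _ (edist_inf B x + hausdorff_edist B C')).
    2: by rewrite leeD2r// hAB.
  have [->|] := eqVneq (hausdorff_edist B C') +oo.
    by rewrite addey ?leey// (lt_eqF _).
  rewrite -ltey => Hfin.
  have Hnum : hausdorff_edist B C' \is a fin_num.
    by rewrite ge0_fin_numE// hausdorff_edist_ge0.
  rewrite -leeBlDr//; apply: le_ereal_inf_tmp => _ [b Bb <-].
  rewrite leeBlDr//; apply: le_trans (edist_inf_triangle C' x b) _.
  by rewrite leeD2l// hBC.
apply/hausdorff_edist_leP; split => x; first exact: aux.
rewrite addeC (hausdorff_edist_sym A) (hausdorff_edist_sym B); exact: aux.
Qed.

Lemma hausdorff_edist0_ball A B x (e : R) :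
  hausdorff_edist A B <= 0 -> A x -> (0 < e)%R -> exists2 y, B y & ball x e y.
Proof.
move=> /hausdorff_edist_leP[hA _] Ax e0.
have : edist_inf B x < e%:E by rewrite (le_lt_trans (hA _ Ax))// lte_fin.
by move=> /ereal_inf_lt[_ [y By <-] xy]; exists y => //; exact: (@edist_lt_ball _ _ _ (x, y)).
Qed.

Lemma hausdorff_edist_bounded A B (e : R) : (0 < e)%R ->
  A !=set0 -> B !=set0 -> (forall x y, A x -> B y -> ball x e y) ->
  hausdorff_edist A B <= e%:E.
Proof.
move=> e0 [a Aa] [b Bb] H; apply/hausdorff_edist_leP; split => x hx.
  apply: (@le_trans _ _ (edist (x, b))); first by apply: ereal_inf_lbound; exists b.
  by apply: edist_fin => //=; exact: H.
apply: (@le_trans _ _ (edist (x, a))); first by apply: ereal_inf_lbound; exists a.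
by apply: edist_fin => //=; apply: ball_sym; exact: H.
Qed.

End hausdorff_edist_lemmas.

(* The balls of 'rV['M[R]_k]_n are those of the supremum metric on
   R^(n x k x k).  The enumeration is 0-based: gamma_1, ..., gamma_n are
   [gam 0], ..., [gam n.-1]. *)
Definition corr_mx (R : realType) (G : groupType) (d : measure_display)
    (X : measurableType d) (mu : probability X R) (gam : nat -> G)
    (n k : nat) (a : mp_action G mu) (A : 'I_k -> set X) : 'rV['M[R]_k]_n :=
  \row_(p < n) \matrix_(q < k, r < k)
    fine (mu (a (gam p) @` A q `&` A r)).

Definition corr_set (R : realType) (G : groupType) (d : measure_display)
    (X : measurableType d) (mu : probability X R) (gam : nat -> G)
    (n k : nat) (a : mp_action G mu) : set 'rV['M[R]_k]_n :=
  closure [set corr_mx gam n a A | A in @mpartition d X k].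
Arguments corr_set {R G d X mu} gam n k a.

(* The sum over n, k >= 1, reindexed by n.+1, k.+1.  It is finite
   ([act_edist_fin_num]), so taking [fine] in [act_dist] loses nothing. *)
Definition act_edist (R : realType) (G : groupType) (d : measure_display)
    (X : measurableType d) (mu : probability X R) (gam : nat -> G)
    (a b : mp_action G mu) : \bar R :=
  (\sum_(0 <= n <oo) \sum_(0 <= k <oo)
    ((2^-1 : R) ^+ (n.+1 + k.+1))%:E *
      hausdorff_edist (corr_set gam n.+1 k.+1 a) (corr_set gam n.+1 k.+1 b))%E.

Definition act_dist (R : realType) (G : groupType) (d : measure_display)
    (X : measurableType d) (mu : probability X R) (gam : nat -> G)
    (a b : mp_action G mu) : R :=
  fine (act_edist gam a b).

Definition weak_equiv (R : realType) (G : groupType) (d : measure_display)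
    (X : measurableType d) (mu : probability X R) (a b : mp_action G mu) : bool :=
  `[< weakly_contained a b /\ weakly_contained b a >].

Lemma geometric_half_le (R : realType) (c : R) : 0 <= c ->
  (\sum_(0 <= k <oo) ((2^-1 ^+ k.+1) * c)%:E <= c%:E)%E.
Proof.
move=> c0; apply: lime_le.
  by apply: is_cvg_nneseries => k _ _; rewrite lee_fin mulr_ge0// exprn_ge0// invr_ge0.
apply: nearW => m; rewrite sumEFin lee_fin.
suff -> : \sum_(0 <= k < m) (2^-1 ^+ k.+1 * c) = c - 2^-1 ^+ m * c.
  by rewrite gerBl mulr_ge0// exprn_ge0// invr_ge0.
elim: m => [|m IH]; first by rewrite big_nil expr0 mul1r subrr.
rewrite big_nat_recr//= IH exprS; lra.
Qed.

Section act_dist_lemmas.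
Context (R : realType) (G : groupType) (d : measure_display).
Context (X : measurableType d) (mu : probability X R) (gam : nat -> G).
Implicit Types a b c : mp_action G mu.

Local Notation C n k a := (corr_set gam n.+1 k.+1 a).
Local Notation H n k a b := (hausdorff_edist (C n k a) (C n k b)).
Local Notation T n k a b :=
  (((2^-1 : R) ^+ (n.+1 + k.+1))%:E * H n k a b)%E.

Let trivial_partition k : @mpartition d X k.+1 (fun i => if i == ord0 then setT else set0).
Proof.
split; first by move=> i; case: ifP.
- apply/trivIsetP => i j _ _; case: (eqVneq i ord0) => [->|_]; last by rewrite set0I.
  by rewrite eq_sym => /negPf ->; rewrite setI0.
- by apply/seteqP; split => // x _; exists ord0 => //; rewrite eqxx.
Qed.

Let C0 n k a : C n k a !=set0.
Proof. by eexists; apply: subset_closure; eexists; first exact: trivial_partition. Qed.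

Let H0 n k a b : (0 <= H n k a b)%E.
Proof. by apply: hausdorff_edist_ge0; exact: C0. Qed.

Let T0 n k a b : (0 <= T n k a b)%E.
Proof. by rewrite mule_ge0// lee_fin exprn_ge0// invr_ge0. Qed.

Let S0 n a b : (0 <= \sum_(0 <= k <oo) T n k a b)%E.
Proof. by apply: nneseries_ge0 => k _ _; exact: T0. Qed.
#[local] Hint Resolve C0 H0 T0 S0 : core.

Let H_le n k a b : (H n k a b <= 4%:E)%E.
Proof.
apply: hausdorff_edist_bounded; [by []|exact: C0|exact: C0|] => x y.
move=> /(_ (ball x 1) (nbhsx_ballx x 1 ltr01))[_ [[A pA <-] xA]].
move=> /(_ (ball y 1) (nbhsx_ballx y 1 ltr01))[_ [[B pB <-] yB]].
have -> : 4 = 1 + 2 + 1 :> R by ring.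
apply: ball_triangle (ball_sym yB); apply: ball_triangle xA _.
split => // i j; split => // q r; rewrite !mxE /ball/= ltr_distl.
have [mA _ _] := pA; have [mB _ _] := pB.
have P1 E : measurable E -> fine (mu E) <= 1.
  by move=> mE; rewrite -(pr_T mu) pr_le.
have := pr_ge0 mu (a (gam j) @` A q `&` A r).
have := pr_ge0 mu (b (gam j) @` B q `&` B r).
have := P1 (a (gam j) @` A q `&` A r) (measurableI _ _ (measurable_act _ _ (mA q)) (mA r)).
have := P1 (b (gam j) @` B q `&` B r) (measurableI _ _ (measurable_act _ _ (mB q)) (mB r)).
by move=> ? ? ? ?; apply/andP; split; lra.
Qed.

Lemma act_edist_ge0 a b : (0 <= act_edist gam a b)%E.
Proof. by apply: nneseries_ge0 => n _ _; exact: S0. Qed.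

Lemma act_edist_fin_num a b : act_edist gam a b \is a fin_num.
Proof.
rewrite ge0_fin_numE ?act_edist_ge0// (@le_lt_trans _ _ 4%:E) ?ltry//.
apply: le_trans (geometric_half_le (ler0n _ 4)).
apply: lee_nneseries => [n _ _|n _]; first exact: S0.
have e0 : 0 <= 2^-1 ^+ n.+1 * 4 :> R by rewrite mulr_ge0// exprn_ge0// invr_ge0.
apply: le_trans (geometric_half_le e0).
apply: lee_nneseries => [k _ _|k _]; first exact: T0.
by rewrite mulrCA [X in (_ <= X%:E)%E]mulrA -exprD EFinM lee_wpmul2l.
Qed.

Lemma act_edistE a b : act_edist gam a b = (act_dist gam a b)%:E.
Proof. by rewrite fineK// act_edist_fin_num. Qed.

Lemma act_dist_ge0 a b : 0 <= act_dist gam a b.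
Proof. by rewrite fine_ge0// act_edist_ge0. Qed.

Lemma act_distC a b : act_dist gam a b = act_dist gam b a.
Proof.
rewrite /act_dist; suff -> : act_edist gam a b = act_edist gam b a by [].
apply: eq_eseriesr => n _; apply: eq_eseriesr => k _.
by rewrite hausdorff_edist_sym.
Qed.

Lemma act_dist_triangle b a c :
  act_dist gam a c <= act_dist gam a b + act_dist gam b c.
Proof.
suff : (act_edist gam a c <= act_edist gam a b + act_edist gam b c)%E.
  by rewrite !act_edistE -EFinD lee_fin.
pose S a b n := (\sum_(0 <= k <oo) T n k a b)%E.
rewrite /act_edist.
have := @nneseriesD R (S a b) (S b c) xpredT 0%N
  (fun n _ _ => S0 n a b) (fun n _ _ => S0 n b c).
move=> <-; apply: lee_nneseries => [n _ _|n _]; first exact: S0.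
have := @nneseriesD R (fun k => T n k a b) (fun k => T n k b c) xpredT 0%N
  (fun k _ _ => T0 n k a b) (fun k _ _ => T0 n k b c).
rewrite /S => <-; apply: lee_nneseries => [k _ _|k _]; first exact: T0.
rewrite -ge0_muleDr; [|exact: H0|exact: H0].
rewrite lee_wpmul2l//.
by apply: hausdorff_edist_triangle; exact: C0.
Qed.

Lemma corr_set_weakly_contained a b n k :
  weakly_contained a b -> C n k a `<=` C n k b.
Proof.
move=> wab; suff /closure_subset : [set corr_mx gam n.+1 a A | A in
    @mpartition d X k.+1] `<=` C n k b.
  by rewrite -((closure_id _).1 (@closed_closure _ _)).
move=> _ [A pA <-] U /nbhs_ballP[e /= e0 eU].
have [B [pB HB]] := weakly_contained_mpartition wab pA
  (finite_image (gam : nat -> G) (finite_II n.+1)) e0.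
exists (corr_mx gam n.+1 b B); split; first by exists B.
apply: eU; split => // i j; split => // q r; rewrite !mxE /ball/=.
by apply: HB; exists (j : nat) => //=.
Qed.

Lemma act_dist_weak_equiv a b : weak_equiv a b -> act_dist gam a b = 0.
Proof.
move=> /asboolP[wab wba]; apply: EFin_inj; rewrite -act_edistE.
apply: eseries0 => n _ _; apply: eseries0 => k _ _.
rewrite (_ : H n k a b = 0%E) ?mule0//.
apply/eqP; rewrite eq_le H0 andbT (_ : C n k a = C n k b) ?hausdorff_edist_refl//.
by apply/seteqP; split; exact: corr_set_weakly_contained.
Qed.

Lemma act_dist0_hausdorff a b n k :
  act_dist gam a b = 0 -> (H n k a b <= 0)%E.
Proof.
move=> ab0; have : (T n k a b <= 0)%E.
  rewrite -[leRHS]/(0%:E) -ab0 -act_edistE.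
  apply: (@le_trans _ _ (\sum_(0 <= k <oo) T n k a b)%E).
    apply: le_trans (nneseries_lim_ge k.+1 _) => [|*//].
    by rewrite big_nat_recr//= leeDr// sume_ge0.
  apply: le_trans (nneseries_lim_ge n.+1 _) => [|*//].
  by rewrite big_nat_recr//= leeDr// sume_ge0.
by rewrite pmule_rle0// lte_fin exprn_gt0// invr_gt0.
Qed.

End act_dist_lemmas.

Lemma act_dist0_weakly_contained (R : realType) (G : groupType)
    (d : measure_display) (X : measurableType d) (mu : probability X R)
    (gam : {surj [set: nat] >-> [set: G]}) (a b : mp_action G mu) :
  act_dist gam a b = 0 -> weakly_contained a b.
Proof.
move=> ab0; apply: (mpartition_weakly_contained (gam := gam)).
move=> [//|n] [//|k] A e _ _ pA e0.
have e20 : 0 < e / 2 by rewrite divr_gt0.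
have [y Cy Ay] : exists2 y, corr_set gam n.+1 k.+1 b y &
    ball (corr_mx gam n.+1 a A) (e / 2) y.
  apply: (hausdorff_edist0_ball (act_dist0_hausdorff n k ab0)) => //.
  by apply: subset_closure; exists A.
have [_ [[B pB <-] yB]] := Cy (ball y (e / 2)) (nbhsx_ballx y _ e20).
exists B; split => // p q r.
have [_ /(_ ord0 p)[_ /(_ q r)]] := ball_triangle Ay yB.
by rewrite !mxE -splitr.
Qed.

Section weak_equiv_lemmas.
Context (R : realType) (G : groupType) (d : measure_display).
Context (X : measurableType d) (mu : probability X R).
Implicit Types a b c : mp_action G mu.

Lemma weakly_contained_refl a : weakly_contained a a.
Proof.
by move=> n A F e mA _ e0; exists A; split => // g i j _; rewrite subrr normr0.
Qed.

Lemma weakly_contained_trans b a c :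
  weakly_contained a b -> weakly_contained b c -> weakly_contained a c.
Proof.
move=> ab bc n A F e mA fF e0; have e20 : 0 < e / 2 by rewrite divr_gt0.
have [B [mB HB]] := ab n A F _ mA fF e20.
have [C [mC HC]] := bc n B F _ mB fF e20.
exists C; split => // g i j Fg.
rewrite (splitr e) (le_lt_trans (ler_distD (fine (mu (b g @` B i `&` B j))) _ _))//.
by rewrite ltrD ?HB ?HC.
Qed.

Lemma weak_equiv_refl : reflexive (@weak_equiv R G d X mu).
Proof. by move=> a; apply/asboolP; split; exact: weakly_contained_refl. Qed.

Lemma weak_equiv_sym : symmetric (@weak_equiv R G d X mu).
Proof. by move=> a b; apply/asboolP/asboolP => -[]. Qed.

Lemma weak_equiv_trans : transitive (@weak_equiv R G d X mu).
Proof.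
move=> b a c /asboolP[ab ba] /asboolP[bc cb]; apply/asboolP.
by split; apply: (@weakly_contained_trans b).
Qed.

Lemma ae_eq_weak_equiv a b :
  (forall g, {ae mu, forall x, a g x = b g x}) -> weak_equiv a b.
Proof.
have aux a' b' : (forall g, {ae mu, forall x, a' g x = b' g x}) ->
    weakly_contained a' b'.
  move=> ab n A F e mA _ e0; exists A; split => // g i j _.
  suff -> : mu (a' g @` A i `&` A j) = mu (b' g @` A i `&` A j).
    by rewrite subrr normr0.
  have mI c : measurable (c g @` A i `&` A j).
    by apply: measurableI => //; exact: measurable_act.
  have [N [mN N0 abN]] := ab g^-1%g.
  have muE S : measurable S -> mu S = mu (S `\` N).
    move=> mS; rewrite (measureDI mu mS mN).
    rewrite [X in (_ + X)%E](_ : _ = 0%E) ?adde0//.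
    apply/eqP; rewrite -measure_le0 -N0.
    by apply: le_measure; rewrite ?inE//; exact: measurableI.
  rewrite (muE _ (mI a')) (muE _ (mI b')) !act_imageE; congr (mu _).
  have abE x : ~ N x -> a' g^-1%g x = b' g^-1%g x.
    by move=> Nx; apply: contrapT => abx; apply: Nx; exact: abN.
  by apply/seteqP; split => x [[/= Ax Ajx] Nx]; split => //; split => //=;
    move: Ax; rewrite abE.
move=> ab; apply/asboolP; split; first exact: aux.
by apply: aux => g; apply: filterS (ab g) => x ->.
Qed.

End weak_equiv_lemmas.

HB.instance Definition _ (R : realType) (G : groupType) (d : measure_display)
    (X : measurableType d) (mu : probability X R) :=
  gen_eqMixin (mp_action G mu).
HB.instance Definition _ (R : realType) (G : groupType) (d : measure_display)
    (X : measurableType d) (mu : probability X R) :=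
  gen_choiceMixin (mp_action G mu).

Canonical weak_equiv_rel (R : realType) (G : groupType) (d : measure_display)
    (X : measurableType d) (mu : probability X R) :=
  EquivRel (@weak_equiv R G d X mu) (@weak_equiv_refl R G d X mu)
    (@weak_equiv_sym R G d X mu) (@weak_equiv_trans R G d X mu).

(* A_~(G, X, mu); the enumeration [gam] only serves to metrize it. *)
Definition weak_quot (R : realType) (G : groupType) (d : measure_display)
    (X : measurableType d) (mu : probability X R)
    (gam : {surj [set: nat] >-> [set: G]}) : Type :=
  {eq_quot @weak_equiv R G d X mu}%qT.

Section weak_quot_metric.
Context (R : realType) (G : groupType) (d : measure_display).
Context (X : measurableType d) (mu : probability X R).
Variable gam : {surj [set: nat] >-> [set: G]}.
Local Open Scope quotient_scope.
Local Notation Q := (weak_quot mu gam).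

HB.instance Definition _ := Choice.on Q.
HB.instance Definition _ := EqQuotient.on Q.

Definition quot_dist (x y : Q) : R := act_dist gam (repr x) (repr y).

Lemma quot_dist_pi (a b : mp_action G mu) :
  quot_dist (\pi_Q a) (\pi_Q b) = act_dist gam a b.
Proof.
have reprE c : act_dist gam (repr (\pi_Q c)) c = 0.
  by apply: act_dist_weak_equiv; rewrite -eqmodE reprK.
apply/eqP; rewrite eq_le; apply/andP; split.
  apply: le_trans (act_dist_triangle gam a _ _) _.
  rewrite reprE add0r (le_trans (act_dist_triangle gam b _ _))//.
  by rewrite (act_distC _ b) reprE addr0.
apply: le_trans (act_dist_triangle gam (repr (\pi_Q a)) _ _) _.
rewrite act_distC reprE add0r.
apply: le_trans (act_dist_triangle gam (repr (\pi_Q b)) _ _) _.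
by rewrite reprE addr0.
Qed.

Let quot_distxx x : quot_dist x x = 0.
Proof. by apply: act_dist_weak_equiv; exact: weak_equiv_refl. Qed.

Let quot_dist_positivity x y : quot_dist x y = 0 -> x = y.
Proof.
move=> xy0; rewrite -[x]reprK -[y]reprK; apply/eqmodP/asboolP; split.
  exact: act_dist0_weakly_contained xy0.
by apply: (@act_dist0_weakly_contained _ _ _ _ _ gam); rewrite act_distC.
Qed.

Let quot_distC x y : quot_dist x y = quot_dist y x.
Proof. exact: act_distC. Qed.

Let quot_dist_triangle y x z : quot_dist x z <= quot_dist x y + quot_dist y z.
Proof. exact: act_dist_triangle. Qed.

HB.instance Definition _ := isMetric.Build R Q
  quot_distxx quot_dist_positivity quot_distC quot_dist_triangle.

Lemma mdist_pi (a b : mp_action G mu) :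
  mdist (\pi_Q a : Q) (\pi_Q b : Q) = act_dist gam a b.
Proof. exact: quot_dist_pi. Qed.

End weak_quot_metric.

(* Main.v *)
Require Import Defs.
From HB Require Import structures.
From mathcomp Require Import all_boot all_order all_algebra.
From mathcomp Require Import generic_quotient.
From mathcomp Require Import all_classical all_reals all_analysis.
From mathcomp Require Import measurable_realfun.
From mathcomp Require Import ring lra.

Set Implicit Arguments.
Unset Strict Implicit.
Unset Printing Implicit Defensive.

Import Order.TTheory GRing.Theory Num.Theory.
Import numFieldNormedType.Exports.

Local Open Scope classical_set_scope.
Local Open Scope ring_scope.

(** Convex combinations of actions give the path.  For actions a and b and t in
[0, 1], let t a + (1 - t) b act on two copies of X, of masses t and 1 - t, by a
on the first one and by b on the second.  A partition of the two copies is a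
pair of partitions of X, so the correlation matrices of the combination are
exactly the t M + (1 - t) M' with M a correlation matrix of a and M' one of b
([mixture]).  The entries of M and M' lie in [0, 1], so passing from s to t
moves each of these matrices by at most |s - t|.  Hence the combinations for s
and t are at distance at most |s - t| ([mixture_act_dist]), and
t |-> t a + (1 - t) b is a 1-Lipschitz path from b to a.

The combination must act on X itself, so X has to be identified, up to null
sets, with two weighted copies of itself ([sum_iso]).  The unit interval is such
a union: [0, t) and [t, 1) are affine images of [0, 1).  What is needed is
therefore a uniformly distributed coordinate F on X with a measurable inverse
defined almost everywhere ([uniform_coordinate]).  It is obtained in two steps.
A standard Borel space embeds in the line by a Borel map with a Borel left
inverse ([standard_borel_embedding]): a point is coded by the balls of a
countable base that contain it, and by completeness the codes of points are
recognized by countably many conditions.  As there are no atoms, the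
distribution function of the embedding takes all values strictly between 0 and
1, and composing the embedding with it makes the law uniform; only countably
many null fibres are collapsed, and a quantile function undoes the
composition elsewhere.

The group laws of an action hold at every point and not only almost everywhere,
so the combined action is defined on a conull set that is invariant by
construction, and is the identity outside it ([sum_action]). *)

(** * Coding a sequence of sets in one real number *)

Lemma preimage_measurable (d d' : measure_display) (X : measurableType d)
    (Y : measurableType d') (f : X -> Y) (A : set Y) :
  measurable_fun setT f -> measurable A -> measurable (f @^-1` A).
Proof. by move=> mf mA; rewrite -[X in measurable X]setTI; exact: mf. Qed.

Section digit_coding.
Context (R : realType) (d : measure_display) (X : measurableType d).
Variable V : nat -> set X.
Hypothesis mV : forall n, measurable (V n).

(* The weight is 2 * 4^-(k+1), in the form that [geometric_half_le] bounds. *)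
Let term n k x : \bar R := ((2^-1 ^+ k.+1) * (2^-1 ^+ k * \1_(V (n + k)%N) x))%:E.

Let term_ge0 n k x : (0 <= term n k x)%E.
Proof. by rewrite lee_fin !mulr_ge0 ?exprn_ge0 ?invr_ge0. Qed.

Let coding n x : \bar R := (\sum_(0 <= k <oo) term n k x)%E.

Let coding_ge0 n x : (0 <= coding n x)%E.
Proof. by apply: nneseries_ge0 => k _ _; exact: term_ge0. Qed.

Let coding_le1 n x : (coding n x <= 1)%E.
Proof.
apply: le_trans (geometric_half_le (@ler01 R)).
apply: lee_nneseries => [k _ _|k _]; first exact: term_ge0.
rewrite lee_fin ler_wpM2l ?exprn_ge0 ?invr_ge0// mulr_ile1 ?exprn_ge0 ?invr_ge0// exprn_ile1 ?invr_ge0//.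
by rewrite invf_le1 ?ler1n.
Qed.

Let coding_fin n x : coding n x \is a fin_num.
Proof. by rewrite ge0_fin_numE// (le_lt_trans (coding_le1 n x)) ?ltry. Qed.

Let codeR n x : R := fine (coding n x).

Let codeR_ge0 n x : 0 <= codeR n x.
Proof. exact: fine_ge0. Qed.

Let codeR_le1 n x : codeR n x <= 1.
Proof. by rewrite -lee_fin fineK. Qed.

Let codeRS n x : codeR n x = 2^-1 * \1_(V n) x + 4^-1 * codeR n.+1 x.
Proof.
apply: EFin_inj; rewrite EFinD (EFinM 4^-1) !fineK// /coding nneseries_recl//.
rewrite {1}/term !expr1 expr0 mul1r addn0; congr (_ + _)%E.
rewrite -(nneseries_addn 1)// -nneseriesZl//; apply: eq_eseriesr => k _.
rewrite /term -EFinM addn1 addSn addnS !exprS; congr EFin.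
by rewrite (_ : 4^-1 = 2^-1 * 2^-1 :> R); [ring|rewrite -invfM; congr _^-1; ring].
Qed.

Let shift (y : R) : R := 4 * y - 2 * \1_(`[2^-1, +oo[%classic) y.

Let half_codeR n x : (2^-1 <= codeR n x) = (x \in V n).
Proof.
rewrite codeRS indicE; have := codeR_ge0 n.+1 x; have := codeR_le1 n.+1 x.
by case: (x \in V n) => /= c1 c0; [apply/idP|apply/negbTE; rewrite -ltNge]; lra.
Qed.

Let shift_codeR n x : shift (codeR n x) = codeR n.+1 x.
Proof.
rewrite /shift indicE mem_setE in_itv/= andbT half_codeR codeRS indicE.
by case: (x \in V n) => /=; lra.
Qed.

(** The base four digits of h x are 2 or 0 according to membership of x in the
sets V n.  With these digits a number is at least 1/2 or at most 1/4, which
reveals its first digit; the other ones appear when the digits are shifted to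
the left, and the shift is piecewise affine. *)
Lemma digit_coding : exists (h : X -> R) (B : nat -> set R),
  [/\ measurable_fun setT h, forall x, 0 <= h x <= 1,
      forall n, measurable (B n) & forall n, h @^-1` B n = V n].
Proof.
exists (codeR 0), (fun n => iter n shift @^-1` `[2^-1, +oo[%classic); split.
- apply: (measurableT_comp (@fine_measurable R setT measurableT)).
  apply: (ge0_emeasurable_sum (P := xpredT)) => // k _.
  apply/measurable_EFinP; apply: measurable_funM => //.
  by apply: measurable_funM => //; exact: measurable_indic.
- by move=> x; rewrite codeR_ge0 codeR_le1.
- move=> n; apply: preimage_measurable => //.
  have : measurable_fun setT (iter n shift).
    elim: n => [|n IH]; first exact: measurable_id.
    apply: (@measurableT_comp _ _ _ _ _ _ shift) => //.
    by apply: measurable_funB => //; apply: measurable_funM.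
  by apply => //; exact: measurable_itv.
- move=> n; have iterE x : iter n shift (codeR 0 x) = codeR n x.
    by elim: n => //= n ->; exact: shift_codeR.
  apply/seteqP; split => x /=; rewrite iterE in_itv/= andbT half_codeR inE//.
Qed.

End digit_coding.

(** * Points of a complete separable metric space as codes *)

Section ball_codes.
Context (R : realType) (P : metricType R) (c0 : nat -> P).
Hypothesis P_complete :
  forall F : set_system P, ProperFilter F -> cauchy F -> exists p : P, F --> p.
Hypothesis c0_dense : forall (x : P) (e : R), 0 < e -> exists i, mdist x (c0 i) < e.

Local Notation rad k := ((k%:R + 1 : R)^-1).
Local Notation ctr p := (c0 p.1).

Definition ball_code (x : P) : set (nat * nat) :=
  [set p | mdist (ctr p) x < rad p.2].

(** What the balls containing a given point have in common: there are arbitrarily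
small ones, any two are close enough to meet, and a ball belongs to the set
exactly when some member lies well inside it.  These are countably many
conditions on memberships, so they define measurable sets. *)
Definition coherent (C : set (nat * nat)) : Prop :=
  [/\ forall k, exists i, C (i, k),
      forall p q, C p -> C q -> mdist (ctr p) (ctr q) < rad p.2 + rad q.2,
      forall p, C p -> exists q, C q /\ mdist (ctr p) (ctr q) + rad q.2 < rad p.2 &
      forall p q, C q -> mdist (ctr p) (ctr q) + rad q.2 < rad p.2 -> C p].

Let rad_gt0 (k : nat) : 0 < rad k.
Proof. by rewrite invr_gt0 ltr_wpDl. Qed.

Let rad_small (e : R) : 0 < e -> exists K, forall k, (K <= k)%N -> rad k < e.
Proof.
move=> e0; have [K _ HK] := near_infty_natSinv_lt (PosNum e0).
by exists K => k Kk; have := HK k Kk; rewrite /= -natr1.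
Qed.

Lemma small_code_ball (x : P) (e : R) : 0 < e ->
  exists p, ball_code x p /\ 2 * rad p.2 < e.
Proof.
move=> e0; have [K HK] := rad_small (divr_gt0 e0 (ltr0n R 2)).
have [i xi] := c0_dense x (rad_gt0 K).
exists (i, K); split; first by rewrite /ball_code/= metric_sym.
by have := HK K (leqnn K) => /=; lra.
Qed.

Lemma ball_code_coherent x : coherent (ball_code x).
Proof.
split.
- move=> k; have [i xi] := c0_dense x (rad_gt0 k).
  by exists i; rewrite /ball_code/= metric_sym.
- move=> p q; rewrite /ball_code/= => xp xq.
  apply: le_lt_trans (metric_triangle _ x _) _.
  by rewrite (metric_sym x) ltrD.
- move=> p xp; have e0 : 0 < rad p.2 - mdist (ctr p) x by rewrite subr_gt0.
  have [q [xq qe]] := small_code_ball x e0; exists q; split => //.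
  have := metric_triangle (ctr p) x (ctr q); rewrite (metric_sym x).
  by move: xq; rewrite /ball_code/=; lra.
- move=> p q; rewrite /ball_code/= => xq pq.
  by have := metric_triangle (ctr p) (ctr q) x; lra.
Qed.

(** Members of C of radius tending to 0 have centres that form a Cauchy sequence,
since any two members nearly meet.  The limit lies in the closed ball of every
member; the last two conditions replace closed balls by open ones. *)
Lemma coherent_ball_code C : coherent C -> exists x, C = ball_code x.
Proof.
case=> C1 C2 C3 C4; pose u k := c0 (projT1 (cid (C1 k))).
have Cu k : C (projT1 (cid (C1 k)), k) by exact: projT2 (cid (C1 k)).
have [x ux] : exists x : P, u k @[k --> \oo] --> x.
  apply: P_complete; apply: cauchy_exP => e e0.
  have [K HK] := rad_small (divr_gt0 e0 (ltr0n R 2)).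
  exists (u K); exists K => // k /= Kk; rewrite ballEmdist/=.
  apply: lt_le_trans (C2 _ _ (Cu K) (Cu k)) _ => /=.
  by have := HK K (leqnn K); have := HK k Kk; lra.
have Cx p : C p -> mdist (ctr p) x <= rad p.2.
  move=> Cp; apply/ler_addgt0Pl => e e0.
  have e20 : 0 < e / 2 by rewrite divr_gt0.
  have [K HK] := rad_small e20.
  have [K' _ HK'] := metricType_numDomainType.cvgr_dist_lt ux e20.
  have := HK _ (leq_maxl K K'); have := HK' _ (leq_maxr K K') => /=.
  have : mdist (ctr p) (u (maxn K K')) < _ := C2 _ _ Cp (Cu (maxn K K')).
  have := metric_triangle (ctr p) (u (maxn K K')) x.
  by rewrite (metric_sym (u _) x) /=; lra.
exists x; apply/seteqP; split => p.
  move=> /C3[q [/Cx xq pq]]; rewrite /ball_code/=.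
  by have := metric_triangle (ctr p) (ctr q) x; lra.
rewrite /ball_code/= => xp.
have e0 : 0 < rad p.2 - mdist (ctr p) x by rewrite subr_gt0.
have [K HK] := rad_small (divr_gt0 e0 (ltr0n R 2)).
apply: (C4 p _ (Cu K)); rewrite -/(u K) /=.
have : mdist (u K) x <= rad K := Cx _ (Cu K).
have := HK K (leqnn K); have := metric_triangle (ctr p) x (u K).
by rewrite (metric_sym x); lra.
Qed.

Lemma ball_code_inj : injective ball_code.
Proof.
move=> x y xy; apply: (@mdist_positivity R P); apply/eqP.
rewrite eq_le mdist_ge0 andbT; apply/ler_addgt0Pl => e e0; rewrite addr0.
have [p [xp pe]] := small_code_ball x e0.
have yp : ball_code y p by rewrite -xy.
have := metric_triangle x (ctr p) y; rewrite (metric_sym x (ctr p)).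
by move: xp yp; rewrite /ball_code/=; lra.
Qed.

Lemma open_bigcup_code (U : set P) : open U ->
  U = \bigcup_(p in [set p | forall y, ball_code y p -> U y])
        [set x | ball_code x p].
Proof.
move=> oU; apply/seteqP; split => [x Ux|x [p pU xp]]; last exact: pU.
have /nbhs_ballP[e /= e0 eU] := open_nbhs_nbhs (conj oU Ux).
have [p [xp pe]] := small_code_ball x e0.
exists p => // y yp; apply: eU; rewrite ballEmdist/=.
have := metric_triangle x (ctr p) y; rewrite (metric_sym x (ctr p)).
by move: xp yp; rewrite /ball_code/=; lra.
Qed.

End ball_codes.

(** * A Borel embedding of a standard Borel space in the line *)

Section countable_quantifiers.
Context (d : measure_display) (T : measurableType d).

Lemma measurable_exists (I : countType) (F : I -> set T) :
  (forall i, measurable (F i)) -> measurable [set x | exists i, F i x].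
Proof.
move=> mF; rewrite (_ : [set _ | _] = \bigcup_i F i).
  by apply: countable_bigcupT_measurable => //; exact: countableP.
by apply/seteqP; split => x [i]; [exists i|move=> _; exists i].
Qed.

Lemma measurable_forall (I : countType) (F : I -> set T) :
  (forall i, measurable (F i)) -> measurable [set x | forall i, F i x].
Proof.
move=> mF; rewrite (_ : [set _ | _] = ~` [set x | exists i, (~` F i) x]).
  by apply/measurableC/measurable_exists => i; exact: measurableC.
apply/seteqP; split => x /=; first by move=> Fx [i]; apply.
by move=> + i; apply: contra_notP => nFx; exists i.
Qed.

Lemma measurable_const (Q : Prop) : measurable [set _ : T | Q].
Proof.
have [q|nq] := pselect Q; first by rewrite (_ : [set _ | _] = setT)//; apply/seteqP; split => x //=.
by rewrite (_ : [set _ | _] = set0)//; apply/seteqP; split => x //=.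
Qed.

Lemma measurable_cond (Q : Prop) (F : set T) :
  measurable F -> measurable [set x | Q -> F x].
Proof.
move=> mF; have [q|nq] := pselect Q.
  by rewrite (_ : [set _ | _] = F)//; apply/seteqP; split => x //=; exact.
by rewrite (_ : [set _ | _] = setT)//; apply/seteqP; split => x //= _ /nq.
Qed.

Lemma measurable_implies (E F : set T) :
  measurable E -> measurable F -> measurable [set x | E x -> F x].
Proof.
move=> mE mF; rewrite (_ : [set _ | _] = ~` E `|` F).
  by apply: measurableU => //; exact: measurableC.
by apply/seteqP; split => x /=; [case: (pselect (E x)) => Ex H; [right; exact: H|left]|case].
Qed.

End countable_quantifiers.

Lemma measurable_coherent (R : realType) (P : metricType R) (c0 : nat -> P)
    (d : measure_display) (T : measurableType d) (W : nat * nat -> set T) :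
  (forall p, measurable (W p)) ->
  measurable [set y | coherent c0 [set p | W p y]].
Proof.
move=> mW; rewrite (_ : [set y | _] =
  [set y | forall k : nat, exists i : nat, W (i, k) y] `&`
  [set y | forall p q : nat * nat, W p y -> W q y ->
     mdist (c0 p.1) (c0 q.1) < (p.2%:R + 1)^-1 + (q.2%:R + 1)^-1] `&`
  [set y | forall p : nat * nat, W p y -> exists q : nat * nat, W q y /\
     mdist (c0 p.1) (c0 q.1) + (q.2%:R + 1)^-1 < (p.2%:R + 1)^-1] `&`
  [set y | forall p q : nat * nat, W q y ->
     mdist (c0 p.1) (c0 q.1) + (q.2%:R + 1)^-1 < (p.2%:R + 1)^-1 -> W p y]); last first.
  by apply/seteqP; split => y; [case|case=> [[[]]]].
have mcst (Q : Prop) : measurable [set y : T | Q] by exact: measurable_const.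
apply: measurableI; [apply: measurableI; [apply: measurableI|]|].
- by apply: measurable_forall => k; exact: measurable_exists.
- apply: measurable_forall => p; apply: measurable_forall => q.
  apply: measurable_implies; first exact: mW.
  by apply: measurable_implies; [exact: mW|exact: mcst].
- apply: measurable_forall => p; apply: measurable_implies; first exact: mW.
  by apply: measurable_exists => q; apply: measurableI; [exact: mW|exact: mcst].
- apply: measurable_forall => p; apply: measurable_forall => q.
  apply: measurable_implies; first exact: mW.
  by apply: measurable_cond; exact: mW.
Qed.

(** The embedding h has the balls around a dense sequence in its digits, so the
code of a point can be read off a real number.  Real numbers with a coherent
code form a Borel set, on which decoding is a left inverse of h; it is
measurable because the preimage of a ball is given by one digit. *)
Lemma standard_borel_embedding (R : realType) (d : measure_display)
    (X : measurableType d) (x0 : X) : standard_borel R X ->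
  exists (h : X -> R) (e : R -> X),
    [/\ measurable_fun setT h, measurable_fun setT e, cancel h e &
        forall x, 0 <= h x <= 1].
Proof.
case=> P [f [P_complete [D cD dD] [g fK gK] Xborel]].
have dball (x : P) (r : R) : 0 < r -> exists2 y, D y & mdist x y < r.
  move=> r0; have [||y [xy Dy]] := dD (interior (ball x r)).
  - by exists x; apply: nbhsx_ballx.
  - exact: open_interior.
  - by exists y => //; have := interior_subset xy; rewrite ballEmdist.
have /pfcard_geP[D0|[c]] := cD.
  by have [y] := dball (f x0) 1 ltr01; rewrite D0.
have c_dense (x : P) (r : R) : 0 < r -> exists i, mdist x (c i) < r.
  move=> /(dball x)[y Dy xy]; have [i _ ci] := @surj _ _ _ _ c y Dy.
  by exists i; rewrite ci.
pose ballX p := [set x | ball_code c (f x) p].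
have mX (O : set P) : open O -> measurable (f @^-1` O).
  move=> oO; apply/Xborel; apply: sub_sigma_algebra.
  by rewrite image_preimage// -subTset => z _; exists (g z) => //; exact: gK.
have mball p : measurable (ballX p).
  rewrite (_ : ballX p = f @^-1` ball (c p.1) (p.2%:R + 1)^-1); last by rewrite ballEmdist.
  apply: mX; rewrite openE => z zp.
  rewrite ballEmdist/= in zp.
  apply/nbhs_ballP; exists ((p.2%:R + 1)^-1 - mdist (c p.1) z); first by rewrite /= subr_gt0.
  move=> w; rewrite !ballEmdist/= => zw.
  by have := metric_triangle (c p.1) z w; lra.
have [h [B [mh h01 mB hB]]] := @digit_coding R d X
  (fun n => if unpickle n is Some p then ballX p else set0)
  (fun n => match unpickle n as o return measurable (if o is Some p then ballX p else set0) with
            | Some p => mball p | None => measurable0 end).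
pose W (p : nat * nat) := B (pickle p).
have hW x p : W p (h x) <-> ball_code c (f x) p.
  have := hB (pickle p); rewrite pickleK => /seteqP[h1 h2].
  by split => [/h1|/h2].
have codeh x : [set p | W p (h x)] = ball_code c (f x).
  by apply/seteqP; split => p; move/hW.
pose Y := [set y | coherent c [set p | W p y]].
have mY : measurable Y by apply: measurable_coherent => p; exact: mB.
have decode y : exists x : X, Y y -> [set p | W p y] = ball_code c (f x).
  have [Yy|nY] := pselect (Y y); last by exists x0.
  have [z zE] := coherent_ball_code P_complete Yy.
  by exists (g z); rewrite gK.
(* The decoding map, sent to x0 where the code is not that of a point. *)
pose e y := if pselect (Y y) is left _ then projT1 (cid (decode y)) else x0.
have eE y : Y y -> [set p | W p y] = ball_code c (f (e y)).
  by rewrite /e => Yy; case: pselect => // _; exact: projT2 (cid (decode y)) Yy.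
have eN y : ~ Y y -> e y = x0 by rewrite /e; case: pselect.
exists h, e; split => // [_ A mA|x].
  rewrite setTI; move/Xborel : mA.
  rewrite (_ : e @^-1` A = (f \o e) @^-1` (f @` A)); last first.
    apply/seteqP; split => y /=; first by exists (e y).
    by case=> x Ax /(can_inj fK) <-.
  suff : <<s @open P >> `<=` [set S | measurable ((f \o e) @^-1` S)] by exact.
  apply: smallest_sub.
    split => /=.
    - by rewrite preimage_set0.
    - by move=> S mS; rewrite setTD preimage_setC; exact: measurableC.
    - by move=> S mS; rewrite preimage_bigcup; exact: bigcup_measurable.
  move=> O oO /=.
  rewrite (_ : _ @^-1` _ = (Y `&` [set y | exists p : nat * nat,
      (forall z, ball_code c z p -> O z) /\ W p y]) `|`
      (~` Y `&` [set _ | O (f x0)])).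
    apply: measurableU; apply: measurableI => //; [|exact: measurableC|exact: measurable_const].
    apply: measurable_exists => p; apply: measurableI; last exact: mB.
    exact: measurable_const.
  apply/seteqP; split => y /=.
    have [Yy|nY] := pselect (Y y); last by rewrite eN//; right.
    rewrite {1}(open_bigcup_code c_dense oO) => -[p pO ep]; left; split => //.
    by exists p; split => //; move/seteqP : (eE y Yy) => [_ /(_ p)]; exact.
  move=> [[Yy [p [pO Wp]]]|[nY]]; last by rewrite eN.
  by apply: pO; rewrite -(eE _ Yy).
have Yh : Y (h x) by rewrite /Y/= codeh; exact: ball_code_coherent.
apply: (can_inj fK); apply: (ball_code_inj c_dense).
by rewrite -(eE _ Yh) codeh.
Qed.

(** * A uniform coordinate on a nonatomic space *)

Lemma ae_forall_countable (R : realType) (d : measure_display)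
    (X : measurableType d) (mu : {measure set X -> \bar R}) (I : countType)
    (P : I -> X -> Prop) :
  (forall i, {ae mu, forall x, P i x}) -> {ae mu, forall x, forall i, P i x}.
Proof.
move=> aeP; pose Q n x := if unpickle n is Some i then P i x else True.
have : {ae mu, forall x, forall n, Q n x}.
  apply: ae_foralln => n; rewrite /Q; case: (unpickle n) => [i|]; first exact: aeP.
  exact: aeW.
by apply: filterS => x Qx i; have := Qx (pickle i); rewrite /Q pickleK.
Qed.

Definition uniform01 (R : realType) (d : measure_display)
    (X : measurableType d) (mu : probability X R) (F : X -> R) : Prop :=
  measurable_fun setT F /\
  forall y, 0 <= y <= 1 -> mu [set x | F x <= y] = y%:E.

Section uniform01_lemmas.
Context (R : realType) (d : measure_display) (X : measurableType d).
Variables (mu : probability X R) (F : X -> R).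
Hypothesis uF : uniform01 mu F.

Lemma uniform01_preimage A : measurable A -> measurable (F @^-1` A).
Proof. exact: preimage_measurable uF.1. Qed.

Lemma uniform01_measurable_le y : measurable [set x | F x <= y].
Proof.
rewrite (_ : [set _ | _] = F @^-1` `]-oo, y]); first exact: uniform01_preimage.
by apply/seteqP; split => x /=; rewrite in_itv.
Qed.

Lemma uniform01_fiber y : 0 <= y <= 1 -> {ae mu, forall x, F x <> y}.
Proof.
move=> /andP[y0 y1].
have mFy : measurable [set x | F x = y].
  exact: uniform01_preimage (measurable_set1 y).
exists [set x | F x = y]; split => //; last by move=> x /= /contrapT.
apply/eqP; rewrite eq_le measure_ge0 andbT; apply/lee_addgt0Pr => r r0; rewrite add0e.
have mle := uniform01_measurable_le.
pose y' := Num.max 0 (y - r); have y'0 : 0 <= y' by rewrite le_max lexx.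
have y'r : y - r <= y' by rewrite le_max lexx orbT.
have [yE|y_neq0] := eqVneq y 0.
  apply: (@le_trans _ _ (mu [set x | F x <= y])).
    by apply: le_measure; rewrite ?inE// => x /= ->.
  by rewrite uF.2 ?y0// lee_fin yE ltW.
have y'y : y' < y by rewrite /y' gt_max lt_neqAle eq_sym y_neq0 y0 ltrBlDr ltrDl.
have dis : [set x | F x = y] `&` [set x | F x <= y'] = set0.
  by apply/seteqP; split => x //= [->]; rewrite leNgt y'y.
have : (mu [set x | F x = y] + mu [set x | (F x <= y')%R] <= mu [set x | (F x <= y)%R])%E.
  rewrite -measureU//; apply: le_measure; rewrite ?inE//; first exact: measurableU.
  by move=> x /= [->//|/le_trans]; apply; exact: ltW.
rewrite !uF.2 ?y0 ?y1 ?y'0 ?(le_trans (ltW y'y))// -pr_EFin// -EFinD !lee_fin; lra.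
Qed.

End uniform01_lemmas.

Section uniform_coordinate.
Context (R : realType) (d : measure_display) (X : measurableType d).
Variable mu : probability X R.
Hypothesis mu_nonatomic : nonatomic mu.
Variables (h : X -> R) (e : R -> X).
Hypotheses (mh : measurable_fun setT h) (me : measurable_fun setT e).
Hypotheses (hK : cancel h e) (h01 : forall x, 0 <= h x <= 1).

Let m_preim (A : set R) : measurable A -> measurable (h @^-1` A).
Proof. exact: preimage_measurable. Qed.

Let m_le z : measurable [set x | h x <= z].
Proof.
rewrite (_ : [set _ | _] = h @^-1` `]-oo, z]); first exact: m_preim.
by apply/seteqP; split => x /=; rewrite in_itv.
Qed.

Let m_lt z : measurable [set x | h x < z].
Proof.
rewrite (_ : [set _ | _] = h @^-1` `]-oo, z[); first exact: m_preim.
by apply/seteqP; split => x /=; rewrite in_itv.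
Qed.

Let m_eq z : measurable [set x | h x = z].
Proof. exact: m_preim (measurable_set1 z). Qed.

(** A fibre of h has at most one point, hence no subset of intermediate
measure. *)
Lemma nonatomic_fiber z : mu [set x | h x = z] = 0%E.
Proof.
apply/eqP; rewrite eq_le measure_ge0 andbT leNgt; apply/negP => /(mu_nonatomic (m_eq z)).
move=> [B [mB Bz B0]]; apply/negP; rewrite -leNgt.
have [x Bx] : B !=set0 by apply/set0P/negP => /eqP B0'; rewrite B0' measure0 ltxx in B0.
apply: le_measure; rewrite ?inE// => y /= hy.
by rewrite -(hK y) hy -(Bz _ Bx) hK.
Qed.

Let C z := fine (mu [set x | h x <= z]).

Let CE z : (C z)%:E = mu [set x | h x <= z].
Proof. exact: pr_EFin. Qed.

Let C_nd : nondecreasing_fun C.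
Proof. by move=> y z yz; apply: pr_le => // x /= /le_trans; exact. Qed.

Let C_ge0 z : 0 <= C z. Proof. exact: pr_ge0. Qed.

Let C_le1 z : C z <= 1.
Proof. by rewrite -(pr_T mu); apply: pr_le. Qed.

Let C1 z : 1 <= z -> C z = 1.
Proof.
move=> z1; rewrite -(pr_T mu); congr (fine (mu _)); apply/seteqP; split => // x _ /=.
by have /andP[_ hx] := h01 x; exact: le_trans hx z1.
Qed.

Let CN1 : C (-1) = 0.
Proof.
rewrite /C (_ : [set _ | _] = set0) ?measure0//; apply/seteqP; split => // x /=.
by have /andP[hx _] := h01 x; lra.
Qed.

Let small_inv (r : R) : 0 < r -> exists n : nat, n.+1%:R^-1 < r.
Proof.
move=> r0; have [n _ Hn] := near_infty_natSinv_lt (PosNum r0).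
by exists n; exact: Hn n (leqnn n).
Qed.

(** Let z be the supremum of the points where C is at most y.  Continuity of the
measure from below bounds the mass of {h < z} by y, continuity from above bounds
the mass of {h <= z} below by y, and the two masses agree as the fibre of z is
null. *)
Lemma cdf_value y : 0 < y < 1 -> exists z, C z = y.
Proof.
move=> /andP[y0 y1]; pose S := [set z | C z <= y].
have SN1 : S (-1) by rewrite /S/= CN1 ltW.
have S1 z : S z -> z <= 1.
  by rewrite /S/= => Cz; rewrite leNgt; apply/negP => /ltW /C1; lra.
have supS : has_sup S by split; [exists (-1)|exists 1].
pose z := sup S; exists z.
have small s : s < z -> C s <= y.
  by move=> /(sup_gt (ex_intro _ _ SN1))[s' Ss' ss']; apply: le_trans Ss'; exact/C_nd/ltW.
have large s : z < s -> y <= C s.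
  move=> zs; rewrite leNgt; apply/negP => Csy.
  by have : s <= z := ub_le_sup supS.2 (ltW Csy); rewrite leNgt zs.
have n0 (n : nat) : 0 < n.+1%:R^-1 :> R by rewrite invr_gt0.
apply/eqP; rewrite eq_le; apply/andP; split; rewrite -lee_fin CE.
- rewrite (_ : [set x | h x <= z] = [set x | h x < z] `|` [set x | h x = z]); last first.
    apply/seteqP; split => x /=; first by rewrite le_eqVlt => /orP[/eqP|]; [right|left].
    by case=> [/ltW|->].
  rewrite measureU//; last by apply/seteqP; split => x //= [+ xz]; rewrite xz ltxx.
  rewrite [X in (_ + X)%E]nonatomic_fiber adde0.
  pose F n := [set x | h x <= z - n.+1%:R^-1].
  have FE : [set x | h x < z] = \bigcup_n F n.
    apply/seteqP; split => x /=; last first.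
      by move=> [n _] /=; rewrite /F/= => hx; apply: le_lt_trans hx _; rewrite ltrBlDr ltrDl.
    rewrite -subr_gt0 => /small_inv[n Hn].
    by exists n => //=; rewrite /F/= lerBrDr addrC -lerBrDr ltW.
  have := @nondecreasing_cvg_mu _ _ _ mu F (fun n => m_le _); rewrite -FE => /(_ (m_lt z)).
  move=> cF; apply: (@cvge_le _ _ _ _ (mu \o F)) (cF _) => [|n m nm].
    by apply: nearW => n; rewrite /= -CE lee_fin small// ltrBlDr ltrDl.
  apply/subsetPset => x; rewrite /F/= => /le_trans; apply; rewrite lerD2l lerN2.
  by rewrite lef_pV2 ?posrE// ler_nat.
- pose F n := [set x | h x <= z + n.+1%:R^-1].
  have FE : [set x | h x <= z] = \bigcap_n F n.
    apply/seteqP; split => x /=; first by move=> hx n _; rewrite /F/= ler_wpDr// ltW.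
    move=> Fx; apply/ler_addgt0Pr => r r0.
    have [n Hn] := small_inv r0.
    have : h x <= z + n.+1%:R^-1 := Fx n I.
    by move=> /le_trans; apply; rewrite lerD2l ltW.
  have := @nonincreasing_cvg_mu _ _ _ mu F; rewrite -FE => cF.
  apply: (@cvge_ge _ _ _ _ (mu \o F)) (cF _ _ _ _) => //.
  + by apply: nearW => n; rewrite /= -CE lee_fin large// ltrDl.
  + by rewrite -ge0_fin_numE// fin_num_measure//; exact: m_le.
  + by move=> n; exact: m_le.
  + move=> n m nm; apply/subsetPset => x; rewrite /F/= => /le_trans; apply; rewrite lerD2l.
    by rewrite lef_pV2 ?posrE// ler_nat.
Qed.

Let mC : measurable_fun setT C.
Proof. exact: nondecreasing_measurable. Qed.

Let m_F : measurable_fun setT (C \o h).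
Proof. exact: measurableT_comp. Qed.

Let m_Fle y : measurable [set x | C (h x) <= y].
Proof.
rewrite (_ : [set _ | _] = setT `&` (C \o h) @^-1` `]-oo, y]); first exact: m_F.
by apply/seteqP; split => x /=; rewrite in_itv//= => -[].
Qed.

(** If C z = y then {h <= z} contains {C h < y} and is contained in {C h <= y}.
This bounds the mass of {C h <= y} below by y, and above by every larger
value of C. *)
Lemma cdf_uniform01 : uniform01 mu (C \o h).
Proof.
split=> [|y /andP[]]; first exact: m_F.
have lo y' : 0 < y' < 1 -> (y'%:E <= mu [set x | (C (h x) <= y')%R])%E.
  move=> /cdf_value[z <-]; rewrite CE; apply: le_measure; rewrite ?inE//.
  by move=> x /=; exact: C_nd.
have hi y' : 0 <= y' < 1 -> (mu [set x | (C (h x) <= y')%R] <= y'%:E)%E.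
  move=> /andP[y0 y1]; apply/lee_addgt0Pr => r r0; rewrite -EFinD.
  pose s := Num.min (y' + r) ((y' + 1) / 2).
  have ys : y' < s by rewrite lt_min ltrDl r0/=; lra.
  have s1 : s < 1 by rewrite gt_min; apply/orP; right; lra.
  have [z zs] : exists z, C z = s by apply: cdf_value; rewrite (le_lt_trans y0).
  apply: (@le_trans _ _ s%:E); last by rewrite lee_fin ge_min lexx.
  rewrite -zs CE; apply: le_measure; rewrite ?inE// => x /= Cx.
  by rewrite leNgt; apply/negP => /ltW/C_nd; rewrite zs leNgt (le_lt_trans Cx).
rewrite le_eqVlt => /predU1P[<- _|y0].
  by apply/eqP; rewrite eq_le measure_ge0 andbT hi// lexx ltr01.
rewrite le_eqVlt => /predU1P[->|y1].
  rewrite (_ : [set _ | _] = setT) ?probability_setT//.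
  by apply/seteqP; split => x //= _; exact: C_le1.
by apply/eqP; rewrite eq_le hi ?lo ?y0 ?ltW.
Qed.

(* The disjunct z = 0 keeps these sets nonempty, so that suprema are monotone. *)
Let below y := [set z | 0 <= z <= 1 /\ (z = 0 \/ C z < y)].

Let below0 y : below y 0.
Proof. by split; [rewrite lexx ler01|left]. Qed.

Let below_sup y : has_sup (below y).
Proof. by split; [exists 0|exists 1 => z [/andP[]]]. Qed.

Let quantile y := sup (below y).

Let quantile_nd : nondecreasing_fun quantile.
Proof.
move=> y y' yy'; apply: sup_le; [|by exists 0|exact: below_sup].
move=> z [z01 zy]; exists z; split => //; split => //.
by case: zy; [left|right; exact: lt_le_trans yy'].
Qed.

Let quantile_cdf x : (forall r : rat, C (h x) <> C (ratr r)) -> quantile (C (h x)) = h x.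
Proof.
move=> Cx; have lt z : z < h x -> C z < C (h x).
  move=> /rat_in_itvoo[r]; rewrite in_itv/= => /andP[/ltW/C_nd zr /ltW/C_nd rx].
  by rewrite (le_lt_trans zr)// lt_neqAle rx andbT; apply/eqP => /esym/Cx.
have /andP[hx0 hx1] := h01 x.
apply/eqP; rewrite eq_le; apply/andP; split.
  apply: ge_sup; first by exists 0.
  move=> z [_ [->//|Cz]]; rewrite leNgt; apply/negP => /ltW/C_nd.
  by rewrite leNgt Cz.
rewrite leNgt; apply/negP => qx.
have q0 : 0 <= quantile (C (h x)) by apply: (ub_le_sup (below_sup _).2); exact: below0.
pose w := (quantile (C (h x)) + h x) / 2.
have : w <= quantile (C (h x)).
  apply: (ub_le_sup (below_sup _).2); split; first by rewrite /w; lra.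
  by right; apply: lt; rewrite /w; lra.
by rewrite /w; lra.
Qed.

(** The function C fails to be injective on the intervals where it is constant.
If z < h x and C z = C (h x), then C (h x) is also the value of C at some
rational number.  Each of these countably many values has a null fibre, and
the quantile function recovers h x at all other points. *)
Lemma uniform_coordinate : exists (F : X -> R) (s : R -> X),
  [/\ uniform01 mu F, measurable_fun setT s & {ae mu, forall x, s (F x) = x}].
Proof.
exists (C \o h), (e \o quantile); split; first exact: cdf_uniform01.
  by apply: measurableT_comp => //; exact: nondecreasing_measurable.
have aeC (r : rat) : {ae mu, forall x, C (h x) <> C (ratr r)}.
  by apply: (uniform01_fiber cdf_uniform01); rewrite C_ge0 C_le1.
apply: filterS (ae_forall_countable aeC) => x Cx /=.
by rewrite quantile_cdf// hK.
Qed.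

End uniform_coordinate.

(** * The space as two copies of itself *)

Lemma measure_eq_rays (R : realType)
    (m1 m2 : {measure set R -> \bar R}) :
  (m1 setT < +oo)%E ->
  (forall y : R, m1 `]-oo, y[%classic = m2 `]-oo, y[%classic) ->
  forall A, measurable A -> m1 A = m2 A.
Proof.
move=> m1fin m12 A mA.
apply: (@measure_unique _ R R (@RGenInftyO.G R)
  (fun n => `]-oo, n%:R[%classic)) => //.
- exact: RGenInftyO.measurableE.
- move=> _ _ [x ->] [y ->]; exists (Num.min x y).
  by apply/seteqP; split => z /=; rewrite !in_itv/= lt_min => /andP.
- by move=> n; exists n%:R.
- apply/seteqP; split => // x _; exists (Num.truncn x).+1 => //=.
  by rewrite in_itv/= truncnS_gt.
- by move=> _ [y ->].
- by move=> n; apply: le_lt_trans m1fin; apply: le_measure; rewrite ?inE//; exact: measurable_itv.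
Qed.

(** Both sides are finite measures of A, so they agree as soon as they agree on
rays. *)
Lemma mixture_law (R : realType) (d : measure_display) (X : measurableType d)
    (mu : probability X R) (f g k : X -> R) (t : R) :
  measurable_fun setT f -> measurable_fun setT g -> measurable_fun setT k ->
  0 <= t <= 1 ->
  (forall y, t%:E * mu [set x | (f x < y)%R] + (1 - t)%:E * mu [set x | (g x < y)%R] =
     mu [set x | (k x < y)%R])%E ->
  forall A, measurable A ->
    (t%:E * mu (f @^-1` A) + (1 - t)%:E * mu (g @^-1` A) = mu (k @^-1` A))%E.
Proof.
move=> mf mg mk /andP[t0]; rewrite -subr_ge0 => t1 fgk A mA.
pose F : {RV mu >-> R} := mfun_Sub (mem_set mf).
pose G : {RV mu >-> R} := mfun_Sub (mem_set mg).
pose K : {RV mu >-> R} := mfun_Sub (mem_set mk).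
pose m : {measure set R -> \bar R} := measure_add
  (mscale (NngNum t0) (distribution mu F)) (mscale (NngNum t1) (distribution mu G)).
have mE B : m B = (t%:E * mu (f @^-1` B) + (1 - t)%:E * mu (g @^-1` B))%E.
  exact: measure_addE.
rewrite -mE; apply: (measure_eq_rays (m2 := distribution mu K)) => //.
  by rewrite mE !preimage_setT probability_setT !mule1 -EFinD ltry.
move=> y; have ray (l : X -> R) : l @^-1` `]-oo, y[ = [set x | l x < y].
  by apply/seteqP; split => x /=; rewrite in_itv.
by rewrite mE /distribution /pushforward/= !ray fgk.
Qed.

Lemma measure_ae_eq (R : realType) (d : measure_display) (X : measurableType d)
    (mu : {measure set X -> \bar R}) (A B : set X) :
  measurable A -> measurable B -> {ae mu, forall x, A x <-> B x} -> mu A = mu B.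
Proof.
suff le E E' : measurable E -> measurable E' -> {ae mu, forall x, E x <-> E' x} ->
    (mu E <= mu E')%E.
  move=> mA mB AB; apply/eqP; rewrite eq_le !le//.
  by apply: filterS AB => x [? ?]; split.
move=> mE mE' [N [mN N0 EN]].
apply: (@le_trans _ _ (mu (E' `|` N))).
  apply: le_measure; rewrite ?inE//; first exact: measurableU.
  move=> x Ex; have [Nx|nNx] := pselect (N x); first by right.
  have [EE' _] : E x <-> E' x by apply: contrapT => /EN.
  by left; exact: EE'.
by rewrite -[leRHS]adde0 -[X in (_ + X)%E]N0; exact: measureU2.
Qed.

Lemma measurable_eq_real (R : realType) (d : measure_display)
    (X : measurableType d) (f g : X -> R) :
  measurable_fun setT f -> measurable_fun setT g -> measurable [set x | f x = g x].
Proof.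
move=> mf mg; have := measurable_fun_eqr mf mg measurableT (I : measurable [set true]).
by rewrite setTI; congr measurable; apply/seteqP; split => x /= /eqP.
Qed.

Section uniform01_rays.
Context (R : realType) (d : measure_display) (X : measurableType d).
Variables (mu : probability X R) (F : X -> R).
Hypothesis uF : uniform01 mu F.

Let measurable_lt y : measurable [set x | F x < y].
Proof.
rewrite (_ : [set _ | _] = F @^-1` `]-oo, y[).
  exact: uniform01_preimage uF _ (measurable_itv _).
by apply/seteqP; split => x /=; rewrite in_itv.
Qed.

Lemma uniform01_lt y : mu [set x | F x < y] = (Num.max 0 (Num.min y 1))%:E.
Proof.
have mle := uniform01_measurable_le uF.
have [y0|y0] := ltP y 0.
  have -> : Num.min y 1 = y by apply/min_idPl; lra.
  have -> : Num.max 0 y = 0 by apply/max_idPl; exact: ltW.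
  apply/eqP; rewrite eq_le measure_ge0 andbT.
  have <- : mu [set x | F x <= 0] = 0%:E by rewrite uF.2// lexx ler01.
  by apply: le_measure; rewrite ?inE// => x /= Fx; apply/ltW/(lt_trans Fx).
have [y1|y1] := leP y 1; last first.
  rewrite max_r ?ler01//; apply/eqP; rewrite eq_le probability_le1//=.
  have <- : mu [set x | F x <= 1] = 1%:E by rewrite uF.2// lexx ler01.
  by apply: le_measure; rewrite ?inE// => x /= /le_lt_trans; apply.
rewrite max_r// -uF.2 ?y0//.
have Fy0 : mu [set x | F x = y] = 0%E.
  have [N [mN N0 FN]] : {ae mu, forall x, F x <> y} by apply: uniform01_fiber; rewrite ?y0.
  apply/eqP; rewrite eq_le measure_ge0 andbT -N0.
  apply: le_measure; rewrite ?inE//.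
    exact: uniform01_preimage uF _ (measurable_set1 y).
  by move=> x /= Fx; apply: FN => /=; exact.
rewrite (_ : [set x | F x <= y] = [set x | F x < y] `|` [set x | F x = y]).
  rewrite measureU//; first by rewrite [X in (_ + X)%E]Fy0 adde0.
    exact: uniform01_preimage uF _ (measurable_set1 y).
  by apply/seteqP; split => x //= [+ xy]; rewrite xy ltxx.
apply/seteqP; split => x /=; first by rewrite le_eqVlt => /orP[/eqP|]; [right|left].
by case=> [/ltW|->].
Qed.

Lemma uniform01_ae : {ae mu, forall x, 0 <= F x < 1}.
Proof.
have F0 : {ae mu, forall x, 0 <= F x}.
  exists [set x | F x < 0]; split => //; last by move=> x /= /negP; rewrite -ltNge.
  rewrite uniform01_lt (min_idPl _) ?ler01// (max_idPl _)//.
have F1 : {ae mu, forall x, F x < 1}.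
  exists (~` [set x | F x < 1]); split => //; first exact: measurableC.
  rewrite probability_setC// uniform01_lt (min_idPl _)// (max_idPr _)// subee//.
by apply: filterS2 F0 F1 => x -> ->.
Qed.

End uniform01_rays.

(** The maps S1 and S2 embed two copies of X, of weights t and 1 - t, in X; T
undoes both, and D contains the first image and misses the second.  So S1 and S2
together form an isomorphism modulo null sets from the weighted disjoint sum of
X and X onto X. *)
Definition sum_iso (R : realType) (d : measure_display) (X : measurableType d)
    (mu : probability X R) (t : R) (S1 S2 T : X -> X) (D : set X) : Prop :=
  [/\ [/\ measurable_fun setT S1, measurable_fun setT S2, measurable_fun setT T &
          measurable D],
      forall A, measurable A ->
        (t%:E * mu (S1 @^-1` A) + (1 - t)%:E * mu (S2 @^-1` A) = mu A)%E,
      {ae mu, forall x, T (S1 x) = x /\ D (S1 x)} &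
      {ae mu, forall x, T (S2 x) = x /\ ~ D (S2 x)}].

(** In the coordinate F the two embeddings are y |-> t y and
y |-> t + (1 - t) y; the mixture of their laws is uniform again.  Since s is an
inverse of F only almost everywhere, one has to know that they almost surely
take values y with F (s y) = y: the exceptional values have measure zero for
the law of F, hence for both parts of the mixture, whose weights are
positive. *)
Lemma uniform01_sum_iso (R : realType) (d : measure_display) (X : measurableType d)
    (mu : probability X R) (F : X -> R) (s : R -> X) (t : R) :
  uniform01 mu F -> measurable_fun setT s -> {ae mu, forall x, s (F x) = x} ->
  0 < t < 1 -> exists S1 S2 T D, sum_iso mu t S1 S2 T D.
Proof.
move=> uF ms sF /andP[t0 t1]; have mF := uF.1.
have t1' : 0 < 1 - t by lra.
pose f x := t * F x; pose g x := t + (1 - t) * F x.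
have mf : measurable_fun setT f by exact: measurable_funM.
have mg : measurable_fun setT g by apply: measurable_funD => //; exact: measurable_funM.
have law A : measurable A ->
    (t%:E * mu (f @^-1` A) + (1 - t)%:E * mu (g @^-1` A) = mu (F @^-1` A))%E.
  apply: mixture_law => // [|y]; first by rewrite !ltW.
  have -> : [set x | f x < y] = [set x | F x < y / t].
    by apply/seteqP; split => x /=; rewrite ltr_pdivlMr// mulrC.
  have -> : [set x | g x < y] = [set x | F x < (y - t) / (1 - t)].
    by apply/seteqP; split => x /=; rewrite ltr_pdivlMr// ltrBrDl mulrC.
  rewrite !uniform01_lt//.
  (* Clipping to [0, 1]: u is at least 1 exactly when v is at least 0. *)
  set u := y / t; set v := (y - t) / (1 - t).
  have yu : y = t * u by rewrite /u mulrC divfK// gt_eqF.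
  have yv : y = t + (1 - t) * v by rewrite /v mulrC divfK ?gt_eqF// addrC subrK.
  rewrite -!EFinM -EFinD; congr EFin; rewrite yu.
  rewrite yu in yv; move: yv; clearbody u v => {yu f g mf mg} yv.
  have clampN (z : R) : z <= 0 -> Num.max 0 (Num.min z 1) = 0.
    by move=> z0; rewrite (min_idPl _) ?(max_idPl _)//; lra.
  have clampid (z : R) : 0 <= z <= 1 -> Num.max 0 (Num.min z 1) = z.
    by move=> /andP[z0 z1]; rewrite (min_idPl _) ?(max_idPr _).
  have clampS (z : R) : 1 <= z -> Num.max 0 (Num.min z 1) = 1.
    by move=> z1; rewrite (min_idPr _) ?(max_idPr _).
  have /orP[u0|u0] := le_total u 0.
    have tu0 : t * u <= 0 by nra.
    have v0 : v <= 0 by nra.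
    by rewrite !clampN// !mulr0 addr0.
  have tu0 : 0 <= t * u by nra.
  have /orP[u1|u1] := le_total u 1.
    have tu1 : t * u <= 1 by nra.
    have v0 : v <= 0 by nra.
    by rewrite (clampN v)// (clampid u) ?u0// (clampid (t * u)) ?tu0// mulr0 addr0.
  have v0 : 0 <= v by nra.
  have /orP[v1|v1] := le_total v 1; last first.
    have tu1 : 1 <= t * u by nra.
    by rewrite !clampS//; lra.
  have tu1 : t * u <= 1 by nra.
  by rewrite (clampS u)// (clampid v) ?v0// (clampid (t * u)) ?tu0//; lra.
have mFs : measurable_fun setT (F \o s) by exact: measurableT_comp.
have mNF : measurable (~` [set y | F (s y) = y]).
  by apply: measurableC; apply: (measurable_eq_real mFs (@measurable_id _ _ _)).
have NF0 : mu (F @^-1` (~` [set y | F (s y) = y])) = 0%E.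
  have [N [mN N0 sN]] := sF.
  apply/eqP; rewrite eq_le measure_ge0 andbT -N0.
  apply: le_measure; rewrite ?inE//; first exact: uniform01_preimage uF _ mNF.
  by move=> x /= FsF; apply: sN => /= sFx; apply: FsF; rewrite sFx.
have := law _ mNF; rewrite NF0 => /eqP; rewrite padde_eq0 ?mule_ge0 ?lee_fin ?(ltW t0) ?(ltW t1')//.
rewrite !mule_eq0 !eqe (gt_eqF t0) (gt_eqF t1')/= => /andP[/eqP f0 /eqP g0].
have ae_of (l : X -> R) : measurable_fun setT l ->
    mu (l @^-1` (~` [set y | F (s y) = y])) = 0%E -> {ae mu, forall x, F (s (l x)) = l x}.
  move=> ml l0; exists (l @^-1` (~` [set y | F (s y) = y])); split => //.
  exact: preimage_measurable.
pose D := [set x | F x < t].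
have mD : measurable D.
  rewrite (_ : D = F @^-1` `]-oo, t[).
    exact: uniform01_preimage uF _ (measurable_itv _).
  by apply/seteqP; split => x /=; rewrite in_itv.
pose T x := if F x < t then s (F x / t) else s ((F x - t) / (1 - t)).
exists (s \o f), (s \o g), T, D; split.
- split=> //; [exact: measurableT_comp|exact: measurableT_comp|].
  apply: measurable_fun_ifT; first exact: measurable_fun_ltr.
    by apply: (measurableT_comp ms); exact: measurable_funM.
  by apply: (measurableT_comp ms); apply: measurable_funM => //; exact: measurable_funB.
- move=> A mA; have msA := preimage_measurable ms mA.
  rewrite -[RHS](_ : mu (F @^-1` (s @^-1` A)) = _); first exact: law.
  apply: measure_ae_eq => //; first exact: uniform01_preimage uF _ msA.
  by apply: filterS sF => x /= ->.
- apply: filterS3 (ae_of f mf f0) sF (uniform01_ae uF) => x Fsf sFx /andP[_ Fx1].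
  have Ft : F (s (f x)) < t by rewrite Fsf /f gtr_pMr.
  by split => //; rewrite /T/= Ft Fsf /f mulrC mulKf ?gt_eqF.
- apply: filterS3 (ae_of g mg g0) sF (uniform01_ae uF) => x Fsg sFx /andP[Fx0 _].
  have Ft : F (s (g x)) < t = false.
    by apply/negbTE; rewrite -leNgt Fsg /g lerDl mulr_ge0// ltW.
  split; last by rewrite /D/= Ft.
  by rewrite /T/= Ft Fsg /g addrC addKr mulrC mulKf ?gt_eqF.
Qed.

(** * Convex combinations of actions *)

(** The correlation matrices of c are the convex combinations of those of a with
those of b.  Equality is required for matrices of partitions, before closures
are taken. *)
Definition mixture (R : realType) (G : groupType) (d : measure_display)
    (X : measurableType d) (mu : probability X R) (t : R)
    (a b c : mp_action G mu) : Prop :=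
  let correlations k (A1 A2 A : 'I_k -> set X) := forall g i j,
    fine (mu (c g @` A i `&` A j)) = t * fine (mu (a g @` A1 i `&` A1 j)) +
                                   (1 - t) * fine (mu (b g @` A2 i `&` A2 j)) in
  (forall k A, @mpartition d X k A -> exists A1 A2,
     [/\ mpartition A1, mpartition A2 & correlations k A1 A2 A]) /\
  (forall k A1 A2, @mpartition d X k A1 -> @mpartition d X k A2 ->
     exists A, mpartition A /\ correlations k A1 A2 A).

Section measure_preserving.
Context (R : realType) (d : measure_display) (X : measurableType d).
Variable mu : probability X R.

Lemma ae_preserving (f : X -> X) (P : X -> Prop) :
  measurable_fun setT f -> (forall A, measurable A -> mu (f @^-1` A) = mu A) ->
  {ae mu, forall x, P x} -> {ae mu, forall x, P (f x)}.
Proof.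
move=> mf muf [N [mN N0 PN]]; exists (f @^-1` N); split.
- exact: preimage_measurable.
- by rewrite muf.
- by move=> x nPx; exact: PN.
Qed.

Lemma mpartition_preimage k (A : 'I_k -> set X) (f : X -> X) :
  measurable_fun setT f -> mpartition A -> mpartition (fun i => f @^-1` A i).
Proof.
move=> mf [mA tA UA]; split; first by move=> i; exact: preimage_measurable.
- apply/trivIsetP => i j _ _ ij; rewrite -preimage_setI.
  by move/trivIsetP : tA => /(_ i j I I ij) ->; rewrite preimage_set0.
- by rewrite -preimage_bigcup UA preimage_setT.
Qed.

End measure_preserving.

Section sum_action.
Context (R : realType) (G : groupType) (gam : {surj [set: nat] >-> [set: G]}).
Context (d : measure_display) (X : measurableType d) (mu : probability X R).
Hypothesis measurable_eqX : forall f g : X -> X,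
  measurable_fun setT f -> measurable_fun setT g -> measurable [set x | f x = g x].
Variables (t : R) (S1 S2 T : X -> X) (D : set X).
Hypothesis S12 : sum_iso mu t S1 S2 T D.
Variables a b : mp_action G mu.

Let mS1 : measurable_fun setT S1. Proof. by case: S12 => -[]. Qed.
Let mS2 : measurable_fun setT S2. Proof. by case: S12 => -[]. Qed.
Let mT : measurable_fun setT T. Proof. by case: S12 => -[]. Qed.
Let mD : measurable D. Proof. by case: S12 => -[]. Qed.

(* The points whose whole orbit is treated correctly by S1, S2, T and D.  They
   form invariant sets, which are conull because the group is countable. *)
Let V1 := [set x | forall g, T (S1 (a g x)) = a g x /\ D (S1 (a g x))].
Let V2 := [set x | forall g, T (S2 (b g x)) = b g x /\ ~ D (S2 (b g x))].

Let orbit_measurable (c : mp_action G mu) (W : set X) : measurable W ->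
  measurable [set x | forall g, W (c g x)].
Proof.
move=> mW; rewrite (_ : [set _ | _] = [set x | forall n : nat, W (c (gam n) x)]).
  by apply: measurable_forall => n; exact: preimage_measurable (act_measurable c _) mW.
apply/seteqP; split => x //= Wx g.
by have [n _ <-] := @surj _ _ _ _ gam g I.
Qed.

Let orbit_ae (c : mp_action G mu) (W : X -> Prop) : {ae mu, forall x, W x} ->
  {ae mu, forall x, forall g, W (c g x)}.
Proof.
move=> aeW'; suff : {ae mu, forall x, forall n, W (c (gam n) x)}.
  apply: filterS => x Wx g.
  by have [n _ <-] := @surj _ _ _ _ gam g I.
apply: ae_foralln => n.
exact: (ae_preserving (act_measurable c (gam n)) (act_preserving c (gam n)) aeW').
Qed.

Let mV1 : measurable V1.
Proof.
apply: (@orbit_measurable a [set x | T (S1 x) = x /\ D (S1 x)]).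
apply: measurableI; last exact: preimage_measurable mS1 mD.
by apply: measurable_eqX; [exact: measurableT_comp|exact: measurable_id].
Qed.

Let mV2 : measurable V2.
Proof.
apply: (@orbit_measurable b [set x | T (S2 x) = x /\ ~ D (S2 x)]).
apply: measurableI; last exact: preimage_measurable mS2 (measurableC mD).
by apply: measurable_eqX; [exact: measurableT_comp|exact: measurable_id].
Qed.

Let aeV1 : {ae mu, forall x, V1 x}.
Proof. by have [_ _ H _] := S12; exact: (orbit_ae a H). Qed.

Let aeV2 : {ae mu, forall x, V2 x}.
Proof. by have [_ _ _ H] := S12; exact: (orbit_ae b H). Qed.

Let V1_act g x : V1 x -> V1 (a g x).
Proof. by move=> Vx h; rewrite -actM; exact: Vx. Qed.

Let V2_act g x : V2 x -> V2 (b g x).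
Proof. by move=> Vx h; rewrite -actM; exact: Vx. Qed.

Let V1_S x : V1 x -> T (S1 x) = x /\ D (S1 x).
Proof. by move=> /(_ 1%g); rewrite act1. Qed.

Let V2_S x : V2 x -> T (S2 x) = x /\ ~ D (S2 x).
Proof. by move=> /(_ 1%g); rewrite act1. Qed.

(* The images of V1 and V2, outside of which the combined action is the identity. *)
Let E1 := [set x | [/\ D x, V1 (T x) & S1 (T x) = x]].
Let E2 := [set x | [/\ ~ D x, V2 (T x) & S2 (T x) = x]].

Let mE1 : measurable E1.
Proof.
rewrite (_ : E1 = D `&` (T @^-1` V1 `&` [set x | S1 (T x) = x])).
  apply: measurableI => //; apply: measurableI; first exact: preimage_measurable.
  by apply: measurable_eqX; [exact: measurableT_comp|exact: measurable_id].
by apply/seteqP; split => x; [case|case=> ? []].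
Qed.

Let mE2 : measurable E2.
Proof.
rewrite (_ : E2 = ~` D `&` (T @^-1` V2 `&` [set x | S2 (T x) = x])).
  apply: measurableI; first exact: measurableC.
  apply: measurableI; first exact: preimage_measurable.
  by apply: measurable_eqX; [exact: measurableT_comp|exact: measurable_id].
by apply/seteqP; split => x; [case|case=> ? []].
Qed.

Let sum_act g x :=
  if x \in E1 then S1 (a g (T x)) else if x \in E2 then S2 (b g (T x)) else x.

Let S1_E x : V1 x -> S1 x \in E1.
Proof.
by move=> Vx; have [Tx Dx] := V1_S Vx; apply/mem_set; rewrite /E1/= Tx.
Qed.

Let S2_E x : V2 x -> S2 x \in E2.
Proof.
by move=> Vx; have [Tx Dx] := V2_S Vx; apply/mem_set; rewrite /E2/= Tx.
Qed.

Let sum_act_S1 g x : V1 x -> sum_act g (S1 x) = S1 (a g x).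
Proof. by move=> Vx; have [Tx _] := V1_S Vx; rewrite /sum_act S1_E// Tx. Qed.

Let sum_act_S2 g x : V2 x -> sum_act g (S2 x) = S2 (b g x).
Proof.
move=> Vx; have [Tx nDx] := V2_S Vx; rewrite /sum_act S2_E// Tx ifF//.
by apply/negbTE/negP => /set_mem[].
Qed.

(* Every point is S1 y with y in V1, or S2 y with y in V2, or is fixed. *)
Let sum_actP x (P : X -> Prop) : (forall y, V1 y -> P (S1 y)) ->
  (forall y, V2 y -> P (S2 y)) -> ((forall g, sum_act g x = x) -> P x) -> P x.
Proof.
move=> P1 P2 P3; case: (boolP (x \in E1)) => [/set_mem[_ Vx <-]|xE1]; first exact: P1.
case: (boolP (x \in E2)) => [/set_mem[_ Vx <-]|xE2]; first exact: P2.
by apply: P3 => g; rewrite /sum_act (negbTE xE1) (negbTE xE2).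
Qed.

Let sum_act1 x : sum_act 1%g x = x.
Proof.
apply: (@sum_actP x (fun x => sum_act 1%g x = x)) => [y Vy|y Vy|//].
- by rewrite sum_act_S1// act1.
- by rewrite sum_act_S2// act1.
Qed.

Let sum_actM g h x : sum_act (g * h)%g x = sum_act g (sum_act h x).
Proof.
apply: (@sum_actP x (fun x => sum_act (g * h)%g x = sum_act g (sum_act h x))) => [y Vy|y Vy|E].
- by rewrite !sum_act_S1 ?actM//; exact: V1_act.
- by rewrite !sum_act_S2 ?actM//; exact: V2_act.
- by rewrite !E.
Qed.

Let measurable_sum_act g : measurable_fun setT (sum_act g).
Proof.
have mem (E : set X) : measurable E -> measurable_fun setT (fun x => x \in E).
  move=> mE; apply: (measurable_fun_bool true); rewrite setTI.
  by rewrite (_ : _ @^-1` _ = E)//; apply/seteqP; split => x /=; [move=> /set_mem|move=> /mem_set].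
apply: measurable_fun_ifT; first exact: mem.
  by do 2 apply: measurableT_comp => //; exact: act_measurable.
apply: measurable_fun_ifT; [exact: mem| |exact: measurable_id].
by do 2 apply: measurableT_comp => //; exact: act_measurable.
Qed.

Let sum_iso_eq A A1 A2 : measurable A -> measurable A1 -> measurable A2 ->
  (forall x, V1 x -> A (S1 x) <-> A1 x) -> (forall x, V2 x -> A (S2 x) <-> A2 x) ->
  (mu A = t%:E * mu A1 + (1 - t)%:E * mu A2)%E.
Proof.
move=> mA mA1 mA2 AA1 AA2; case: S12 => _ /(_ _ mA) <- _ _.
congr (_ * _ + _ * _)%E; (apply: measure_ae_eq => //; first exact: preimage_measurable).
- by apply: filterS aeV1 => x; exact: AA1.
- by apply: filterS aeV2 => x; exact: AA2.
Qed.

Let sum_act_preserving g A : measurable A -> mu (sum_act g @^-1` A) = mu A.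
Proof.
move=> mA; case: S12 => _ /(_ _ mA) <- _ _.
have m1 := preimage_measurable mS1 mA; have m2 := preimage_measurable mS2 mA.
rewrite -(act_preserving a g m1) -(act_preserving b g m2).
apply: sum_iso_eq; [exact: preimage_measurable|exact: preimage_measurable (act_measurable a g) m1|
  exact: preimage_measurable (act_measurable b g) m2| |].
- by move=> x Vx; rewrite /= sum_act_S1.
- by move=> x Vx; rewrite /= sum_act_S2.
Qed.

Definition sum_action : mp_action G mu :=
  MpAction measurable_sum_act sum_act1 sum_actM sum_act_preserving.

Lemma sum_action_correlation g A B A1 B1 A2 B2 :
  measurable A -> measurable B -> measurable A1 -> measurable B1 ->
  measurable A2 -> measurable B2 ->
  (forall x, V1 x -> (A (S1 x) <-> A1 x) /\ (B (S1 x) <-> B1 x)) ->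
  (forall x, V2 x -> (A (S2 x) <-> A2 x) /\ (B (S2 x) <-> B2 x)) ->
  fine (mu (sum_action g @` A `&` B)) = t * fine (mu (a g @` A1 `&` B1)) +
                                  (1 - t) * fine (mu (b g @` A2 `&` B2)).
Proof.
move=> mA mB mA1 mB1 mA2 mB2 AB1 AB2.
have mI (c : mp_action G mu) E F : measurable E -> measurable F ->
    measurable (c g @` E `&` F).
  by move=> mE mF; apply: measurableI => //; exact: measurable_act.
apply: EFin_inj; rewrite EFinD !EFinM !pr_EFin//; try exact: mI.
apply: sum_iso_eq; try exact: mI.
- move=> x Vx; rewrite !act_imageE /= sum_act_S1//.
  by rewrite (AB1 _ (V1_act _ Vx)).1 (AB1 _ Vx).2.
- move=> x Vx; rewrite !act_imageE /= sum_act_S2//.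
  by rewrite (AB2 _ (V2_act _ Vx)).1 (AB2 _ Vx).2.
Qed.

(** Pulling a partition back along S1 and S2 gives a pair of partitions; a pair is
glued to one partition along D and its complement, and pulling back recovers
the pair up to null sets. *)
Lemma sum_action_mixture : mixture t a b sum_action.
Proof.
split=> [k A pA|k A1 A2 pA1 pA2].
  exists (fun i => S1 @^-1` A i), (fun i => S2 @^-1` A i).
  have p1 := mpartition_preimage mS1 pA; have p2 := mpartition_preimage mS2 pA.
  split => // g i j; have [mA _ _] := pA; have [m1 _ _] := p1; have [m2 _ _] := p2.
  exact: sum_action_correlation.
pose A i := (D `&` T @^-1` A1 i) `|` (~` D `&` T @^-1` A2 i).
have [m1 t1 U1] := pA1; have [m2 t2 U2] := pA2.
have mA i : measurable (A i).
  by apply: measurableU; apply: measurableI; [|exact: preimage_measurable|exact: measurableC|exact: preimage_measurable].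
exists A; split.
  split => //.
  - apply/trivIsetP => i j _ _ ij; apply/seteqP; split => // x [].
    case=> -[Dx /= Ti] [[Dx' /= Tj]|[Dx' /= Tj]] //.
    + by move/trivIsetP : t1 => /(_ i j I I ij) /seteqP[+ _]; apply; split; eassumption.
    + by move/trivIsetP : t2 => /(_ i j I I ij) /seteqP[+ _]; apply; split; eassumption.
  - apply/seteqP; split => // x _; have [Dx|nDx] := pselect (D x).
    + have [i _ Ai] : (\bigcup_i A1 i) (T x) by rewrite U1.
      by exists i => //; left.
    + have [i _ Ai] : (\bigcup_i A2 i) (T x) by rewrite U2.
      by exists i => //; right.
have AS1 i x : V1 x -> A i (S1 x) <-> A1 i x.
  by move=> /V1_S[Tx Dx]; rewrite /A/= Tx; split; [case=> [[]|[]]|left].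
have AS2 i x : V2 x -> A i (S2 x) <-> A2 i x.
  by move=> /V2_S[Tx Dx]; rewrite /A/= Tx; split; [case=> [[]|[]]|right].
move=> g i j; apply: sum_action_correlation => // x Vx.
- by split; exact: AS1.
- by split; exact: AS2.
Qed.

End sum_action.

(** * The path of convex combinations *)

Lemma mixture0 (R : realType) (G : groupType) (d : measure_display)
    (X : measurableType d) (mu : probability X R) (a b : mp_action G mu) :
  mixture 0 a b b.
Proof.
by split=> [k A pA|k A1 A2 pA1 pA2]; [exists A, A|exists A2]; split => // g i j;
  rewrite mul0r add0r subr0 mul1r.
Qed.

Lemma mixture1 (R : realType) (G : groupType) (d : measure_display)
    (X : measurableType d) (mu : probability X R) (a b : mp_action G mu) :
  mixture 1 a b a.
Proof.
by split=> [k A pA|k A1 A2 pA1 pA2]; [exists A, A|exists A1]; split => // g i j;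
  rewrite mul1r subrr mul0r addr0.
Qed.

(** At t = 0 and t = 1 one of the two copies has no mass and the actions b and a
themselves serve. *)
Lemma mixture_exists (R : realType) (G : groupType)
    (gam : {surj [set: nat] >-> [set: G]}) (d : measure_display)
    (X : measurableType d) (mu : probability X R) (a b : mp_action G mu) (t : R) :
  standard_borel R X -> nonatomic mu -> 0 <= t <= 1 -> exists c, mixture t a b c.
Proof.
move=> sX nmu; have [x0 _] : [set: X] !=set0.
  apply/set0P/negP => /eqP X0; have := probability_setT mu.
  by rewrite X0 measure0 => /eqP; rewrite eqe eq_sym oner_eq0.
have [h [e [mh me hK h01]]] := standard_borel_embedding x0 sX.
have [F [s [uF ms sF]]] := uniform_coordinate nmu mh me hK h01.
rewrite !le_eqVlt => /andP[/predU1P[<- _|t0 /predU1P[->|t1]]].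
- by exists b; exact: mixture0.
- by exists a; exact: mixture1.
have t01 : 0 < t < 1 by rewrite t0.
have [S1 [S2 [T [D S12]]]] := uniform01_sum_iso uF ms sF t01.
have meq (f g : X -> X) : measurable_fun setT f -> measurable_fun setT g ->
    measurable [set x | f x = g x].
  move=> mf mg; rewrite (_ : [set _ | _] = [set x | (h \o f) x = (h \o g) x]).
    by apply: measurable_eq_real; exact: measurableT_comp.
  by apply/seteqP; split => x /= => [->//|/(can_inj hK)].
by exists (sum_action gam meq S12 a b); exact: sum_action_mixture.
Qed.

Section mixture_distance.
Context (R : realType) (G : groupType) (gam : nat -> G).
Context (d : measure_display) (X : measurableType d) (mu : probability X R).
Implicit Types a b c : mp_action G mu.

Lemma corr_set_nonempty n k c : corr_set gam n k.+1 c !=set0.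
Proof.
have pA := @memb_mpartition d X 0 k.+1 (fun=> set0) (fun=> ord0) (fun=> measurable0).
by eexists; apply: subset_closure; eexists; first exact: pA.
Qed.

Lemma act_edist_le c c' (e : R) : 0 <= e ->
  (forall n k,
    (hausdorff_edist (corr_set gam n k c) (corr_set gam n k c') <= e%:E)%E) ->
  (act_edist gam c c' <= e%:E)%E.
Proof.
move=> e0 He.
have term0 n k : (0 <= ((2^-1 : R) ^+ (n.+1 + k.+1))%:E *
    hausdorff_edist (corr_set gam n.+1 k.+1 c) (corr_set gam n.+1 k.+1 c'))%E.
  rewrite mule_ge0 ?lee_fin ?exprn_ge0 ?invr_ge0//.
  by apply: hausdorff_edist_ge0; exact: corr_set_nonempty.
apply: le_trans (geometric_half_le e0).
apply: lee_nneseries => [n _ _|n _]; first by apply: nneseries_ge0 => k _ _.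
have e1 : 0 <= 2^-1 ^+ n.+1 * e by rewrite mulr_ge0// exprn_ge0// invr_ge0.
apply: le_trans (geometric_half_le e1).
apply: lee_nneseries => [//|k _].
by rewrite mulrCA [X in (_ <= X%:E)%E]mulrA -exprD EFinM lee_wpmul2l//.
Qed.

(** Use the same pair of partitions with both weights: an entry changes by
(s - t) (y - x) with x and y in [0, 1]. *)
Lemma mixture_corr_mx a b c c' (s t e : R) n k (A : 'I_k -> set X) :
  mixture s a b c -> mixture t a b c' -> `|s - t| < e -> mpartition A ->
  exists2 B, @mpartition d X k B & ball (corr_mx gam n c A) e (corr_mx gam n c' B).
Proof.
move=> [Hc _] [_ Hc'] ste pA.
have [A1 [A2 [pA1 pA2 cE]]] := Hc k A pA.
have [B [pB c'E]] := Hc' k A1 A2 pA1 pA2.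
exists B => //; have e0 : 0 < e := le_lt_trans (normr_ge0 _) ste.
split => // i j; split => // q r; rewrite !mxE /ball/= cE c'E.
have P01 (f : mp_action G mu) (E : 'I_k -> set X) : mpartition E ->
    0 <= fine (mu (f (gam j) @` E q `&` E r)) <= 1.
  case=> mE _ _; rewrite pr_ge0 -(pr_T mu) pr_le//.
  by apply: measurableI => //; exact: measurable_act.
have /andP[] := P01 a _ pA1; have /andP[] := P01 b _ pA2.
set x := fine _; set y := fine _ => y0 y1 x0 x1.
apply: le_lt_trans ste.
rewrite (_ : _ - _ = (s - t) * (y - x)); last by rewrite /x /y; ring.
by rewrite normrM ler_piMr// ler_norml; apply/andP; split; lra.
Qed.

Lemma mixture_edist a b c c' (s t e : R) n k x :
  mixture s a b c -> mixture t a b c' -> `|s - t| < e ->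
  corr_set gam n k c x -> (edist_inf (corr_set gam n k c') x <= e%:E)%E.
Proof.
move=> Hc Hc' ste cx; have e0 : 0 < e := le_lt_trans (normr_ge0 _) ste.
apply/lee_addgt0Pr => r r0; rewrite -EFinD.
have [_ [[A pA <-] xA]] := cx (ball x r) (nbhsx_ballx x r r0).
have [B pB AB] := mixture_corr_mx n Hc Hc' ste pA.
apply: (@le_trans _ _ (edist (x, corr_mx gam n c' B))).
  apply: ereal_inf_lbound; exists (corr_mx gam n c' B) => //.
  by apply: subset_closure; exists B.
apply: edist_fin => /=; first exact: addr_gt0.
by rewrite addrC; exact: ball_triangle xA AB.
Qed.

Lemma mixture_act_dist a b c c' (s t : R) :
  mixture s a b c -> mixture t a b c' -> act_dist gam c c' <= `|s - t|.
Proof.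
move=> Hc Hc'; apply/ler_addgt0Pr => r r0; set e := _ + r.
have ste : `|s - t| < e by rewrite ltrDl.
have e0 : 0 <= e := le_trans (normr_ge0 _) (ltW ste).
have H n k : (hausdorff_edist (corr_set gam n k c) (corr_set gam n k c') <= e%:E)%E.
  apply/hausdorff_edist_leP; split => x cx; first exact: (mixture_edist Hc Hc') cx.
  by apply: (mixture_edist Hc' Hc) cx; rewrite distrC.
rewrite -lee_fin -act_edistE; exact: act_edist_le.
Qed.

End mixture_distance.

Theorem corollary4p1 (R : realType)
    (G : groupType) (gam : {surj [set: nat] >-> [set: G]})
    (d : measure_display) (X : measurableType d) (mu : probability X R)
    (X_standard : standard_borel R X) (mu_nonatomic : nonatomic mu) :
  path_connected R (weak_quot mu gam).
Proof.
move=> y x; pose a := repr x; pose b := repr y.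
have mix t : exists c, 0 <= t <= 1 -> mixture t a b c.
  have [t01|t01] := boolP (0 <= t <= 1); last by exists a.
  by have [c Hc] := mixture_exists gam a b X_standard mu_nonatomic t01; exists c.
pose c t := projT1 (cid (mix t)).
have cP t : 0 <= t <= 1 -> mixture t a b (c t) := projT2 (cid (mix t)).
pose cls (c' : mp_action G mu) := (\pi_(weak_quot mu gam) c')%qT.
pose f t := cls (c t).
have f_lip s t c' : 0 <= s <= 1 -> mixture t a b c' ->
    mdist (f s) (cls c') <= `|s - t|.
  by move=> s01 tc'; rewrite mdist_pi; exact: mixture_act_dist (cP s s01) tc'.
have f_end t c' : 0 <= t <= 1 -> mixture t a b c' -> f t = cls c'.
  move=> t01 tc'; apply: (@mdist_positivity R (weak_quot mu gam)).
  apply/eqP; rewrite eq_le mdist_ge0 andbT.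
  by apply: le_trans (f_lip _ _ _ t01 tc') _; rewrite subrr normr0.
exists f; split.
- apply/subspace_continuousP => t; rewrite /= in_itv/= => t01.
  apply/metricType_numDomainType.cvgrPdist_lt => e e0.
  rewrite near_withinE; near=> s => /=; rewrite in_itv/= => s01.
  apply: le_lt_trans (f_lip _ _ _ t01 (cP _ s01)) _.
  by near: s; exact: (@cvgr_dist_lt _ _ _ _ _ id t).
- by rewrite (f_end 0 b) ?lexx ?ler01//; [exact: reprK|exact: mixture0].
- by rewrite (f_end 1 a) ?lexx ?ler01//; [exact: reprK|exact: mixture1].
Unshelve. all: by end_near. Qed.
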